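(* Let $\nu\in\{0,\tfrac12\}$, and let $N_1,\dots,N_6\in\mathbb{Z}+\nu$ and $a_1,\dots,a_6\in\mathbb{C}$ satisfy $$\sum_{k=1}^6 N_k=2,\qquad \sum_{k=1}^6 a_k=0 .$$ For $N\in\mathbb{Z}+\nu$ put $$F_N(y)=(y^2-N^2)\prod_{k=1}^6 \Big(1+\tfrac{a_k-N_k+(y-N)}{2}\Big)_{N_k-1+N}\Big(1+\tfrac{a_k-N_k-(y-N)}{2}\Big)_{N_k-1-N},$$ and let $C_N$ be a contour as described in the context. Then $$\frac{1}{8\pi{\rm i}}\sum_{N\in \mathbb{Z} +\nu}\int_{C_N} F_N(y)\, dy =\prod_{1\leq j< k \leq 6}\Big(1+\frac{a_j+ a_k-N_j-N_k}{2}\Big)_{N_j+N_k-1}.$$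
   Context: For $a\in\mathbb{C}$ and $n\in\mathbb{Z}$ the Pochhammer symbol is $(a)_n=\Gamma(a+n)/\Gamma(a)$, i.e. $(a)_0=1$, $(a)_n=a(a+1)\cdots(a+n-1)$ for $n>0$, and $(a)_n=1/\big((a-1)(a-2)\cdots(a+n)\big)$ for $n<0$. Since $N_k\pm N\in\mathbb{Z}$, all Pochhammer indices above are integers, so $F_N$ is a rational function of $y$. Its poles come either from the factors $\big(1+\tfrac{a_k-N_k+(y-N)}{2}\big)_{N_k-1+N}$ (''plus-sign'' factors) or from the factors $\big(1+\tfrac{a_k-N_k-(y-N)}{2}\big)_{N_k-1-N}$ (''minus-sign'' factors). The contour $C_N$ runs from $-\infty$ to $+\infty$, coinciding with the real axis outside a compact set, and separates the poles of the plus-sign factors (lying to its left, i.e. above it) from the poles of the minus-sign factors (lying to its right, i.e. below it); the parameters $a_k$ are assumed generic enough that such contours exist. Only finitely many terms of the sum over $N$ are nonzero. *)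

(* Defs.v *)
From Stdlib Require Import Reals ZArith.
From Coquelicot Require Import Coquelicot.
Open Scope R_scope.
Open Scope C_scope.

Fixpoint prodC (n : nat) (f : nat -> C) : C :=
  match n with
  | O => 1
  | S n' => prodC n' f * f n'
  end.

Fixpoint sumC (n : nat) (f : nat -> C) : C :=
  match n with
  | O => 0
  | S n' => sumC n' f + f n'
  end.

Definition sumZ (M : nat) (f : Z -> C) : C :=
  sumC (2 * M + 1) (fun i => f (Z.of_nat i - Z.of_nat M)%Z).

(* Pochhammer symbol (a)_n = Gamma(a+n)/Gamma(a) with integer index n:
   (a)_0 = 1, (a)_n = a(a+1)...(a+n-1) for n>0,
   (a)_n = 1/((a-1)(a-2)...(a+n)) for n<0. *)
Definition poch (a : C) (n : Z) : C :=
  match n with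
  | Z0 => 1
  | Zpos p => prodC (Pos.to_nat p) (fun i => a + RtoC (INR i))
  | Zneg p => / prodC (Pos.to_nat p) (fun i => a - RtoC (INR (S i)))
  end.

(* y is a pole of the factor y |-> (b y)_n : n < 0 and the denominator
   (b y - 1)(b y - 2)...(b y + n) vanishes at y. *)
Definition poch_pole (b : C -> C) (n : Z) (y : C) : Prop :=
  (n < 0)%Z /\ exists j : nat, (1 <= j)%nat /\ (Z.of_nat j <= - n)%Z /\ b y = RtoC (INR j).

Definition nuR (half : bool) : R := if half then / 2 else 0.
Definition twonu (half : bool) : Z := if half then 1%Z else 0%Z.

(* An element of Z + nu is represented by its integer part z: z + nu. *)
Definition shiftC (half : bool) (z : Z) : C := RtoC (IZR z + nuR half).

Definition plus_arg (half : bool) (a : nat -> C) (n : nat -> Z) (m : Z) (k : nat) (y : C) : C :=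
  1 + (a k - shiftC half (n k) + (y - shiftC half m)) / 2.
(* its index N_k - 1 + N *)
Definition plus_idx (half : bool) (n : nat -> Z) (m : Z) (k : nat) : Z :=
  (n k + m + twonu half - 1)%Z.
Definition minus_arg (half : bool) (a : nat -> C) (n : nat -> Z) (m : Z) (k : nat) (y : C) : C :=
  1 + (a k - shiftC half (n k) - (y - shiftC half m)) / 2.
(* its index N_k - 1 - N *)
Definition minus_idx (n : nat -> Z) (m : Z) (k : nat) : Z :=
  (n k - m - 1)%Z.

(* F_N(y) for N = m + nu, with N_k = n k + nu, k = 0..5 *)
Definition FN (half : bool) (a : nat -> C) (n : nat -> Z) (m : Z) (y : C) : C :=
  (y * y - shiftC half m * shiftC half m) *
  prodC 6 (fun k => poch (plus_arg half a n m k y) (plus_idx half n m k) *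
                    poch (minus_arg half a n m k y) (minus_idx n m k)).

Definition is_contour (g dg : R -> C) : Prop :=
  (forall t, is_derive g t (dg t)) /\
  (forall t, continuous dg t) /\
  (exists T0 : R, forall t, T0 <= Rabs t -> g t = RtoC t).

(* Side of a point p w.r.t. a contour running from -oo to +oo:
   the principal-value winding integral  lim_{T->oo} int_{-T}^{T} g'/(g-p)
   equals  i*pi  (p lies to the left of / above the contour, winding 1/2)
   or  -i*pi  (p lies to the right of / below it, winding -1/2). *)
Definition side_integral (g dg : R -> C) (p : C) (v : C) : Prop :=
  (forall t, g t <> p) /\
  exists w : R -> C,
    (forall T, is_RInt (fun t => dg t / (g t - p)) (- T) T (w T)) /\
    filterlim w (Rbar_locally p_infty) (locally v).

Definition left_of (g dg : R -> C) (p : C) : Prop :=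
  side_integral g dg p ((0%R, PI) : C).
Definition right_of (g dg : R -> C) (p : C) : Prop :=
  side_integral g dg p ((0%R, (- PI)%R) : C).

Definition separating_contour (half : bool) (a : nat -> C) (n : nat -> Z) (m : Z)
    (g dg : R -> C) : Prop :=
  is_contour g dg /\
  (forall k y, (k < 6)%nat -> poch_pole (plus_arg half a n m k) (plus_idx half n m k) y ->
      left_of g dg y) /\
  (forall k y, (k < 6)%nat -> poch_pole (minus_arg half a n m k) (minus_idx n m k) y ->
      right_of g dg y).

Definition is_contour_integral (f : C -> C) (g dg : R -> C) (v : C) : Prop :=
  is_RInt_gen (fun t => f (g t) * dg t) (Rbar_locally m_infty) (Rbar_locally p_infty) v.

(* Main.v *)
(* The integral over a contour is [2 pi i] times the sum of the residues at the poles of the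
   plus-sign factors; splitting [1/((y-p)(y-q))] repeatedly reduces this to the two values
   [+- i pi] that define the sides of the contour, so Cauchy's theorem is not needed.  The residue
   sum is a divided difference of the remaining factors over the plus poles.

   Put [alpha_k = (a_k+N_k)/2], [u = (y+N)/2], [u' = (N-y)/2] and let [V] be the product of the twelve
   Pochhammer factors.  For [sum alpha_k = 0] the function [V u' prod (alpha_k - u)] becomes
   [V u' prod (alpha_k + u)] under [(y, N) -> (y+1, N+1)], so the residue sums of both, taken over
   all [N], agree.  Since [prod (alpha_k + u) - prod (alpha_k - u)] is [u] times a linear combination
   of [alpha_i^2 - u^2] and [alpha_j^2 - u^2], and multiplying [V] by [alpha_i^2 - u^2] amounts to
   shifting [(a_i, N_i)] by [(1, 1)], this gives a two-term relation between the left-hand sides for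
   neighbouring parameters, which the right-hand side satisfies too.  The shifts lead to
   [N = (1,1,0,0,0,0)] or [(1/2,1/2,1/2,1/2,1/2,-1/2)], where only one or two values of [N] contribute.

   The recursion divides by expressions in the [a_k] and uses simple poles, so it is carried out for
   parameters perturbed by generic imaginary amounts; both sides are continuous at the given [a]. *)

Require Import Defs.
From Stdlib Require Import Reals ZArith List Lia Lra Permutation.
From Stdlib Require Import FunctionalExtensionality IndefiniteDescription.
From Coquelicot Require Import Coquelicot.
Open Scope R_scope.
Open Scope C_scope.

(** The weight [y^2 - N^2] is what makes the telescoping close. It equals [-4 u u']: the factor [u']
    is unchanged by [(y, N) -> (y+1, N+1)] and is carried along, while [u] comes out of the
    difference of the two products, which is odd in [u]. The condition [sum alpha_k = 0] belongs to
    intermediate parameters with [sum N_k = 1] and [sum a_k = -1]; raising any single index by one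
    leads back to the sums 2 and 0, and comparing two such indices gives the relation. At the given
    [a] several plus poles may coincide, and then a divided difference over them divides by zero.
    The integrals are therefore computed by a recursion whose only divisors are differences of a
    plus pole and a minus pole, which the contour keeps apart. The same recursion run on perturbed
    poles yields the residue sum, so a single function of the perturbation, continuous at 0,
    connects the integral with the residues. The contour itself stays fixed while the poles move. *)

(** * Complex arithmetic, finite products and sums *)

Lemma Cinv_0 : / RtoC 0 = 0.
Proof.
  unfold Cinv, RtoC; simpl. f_equal; unfold Rdiv; ring.
Qed.

(** Unconditional thanks to the convention [/ 0 = 0]. Through it [dd_perm] holds for repeated nodes
    and [FN_form] holds at the poles as well. *)
Lemma Cinv_mult (x y : C) : / (x * y) = / x * / y.
Proof.
  destruct (Ceq_dec x 0) as [-> | hx].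
  { rewrite Cmult_0_l, Cinv_0. ring. }
  destruct (Ceq_dec y 0) as [-> | hy].
  { rewrite Cmult_0_r, Cinv_0. ring. }
  field. auto.
Qed.

Lemma C_neq_snd (x y : C) : snd x <> snd y -> x <> y.
Proof. intros H ->. auto. Qed.

Lemma Csub_neq_0 (x y : C) : x <> y -> x - y <> 0.
Proof. exact (Cminus_eq_contra x y). Qed.

Lemma C2_neq_0 : RtoC 2 <> 0.
Proof. intros H; apply RtoC_inj in H; lra. Qed.

Ltac push_IZR :=
  repeat first [rewrite plus_IZR | rewrite minus_IZR | rewrite opp_IZR | rewrite mult_IZR];
  repeat first [rewrite RtoC_plus | rewrite RtoC_minus | rewrite RtoC_opp | rewrite RtoC_mult].

Lemma prodC_ext (n : nat) (f g : nat -> C) :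
  (forall i, (i < n)%nat -> f i = g i) -> prodC n f = prodC n g.
Proof.
  induction n as [|n IH]; intros H; simpl; auto.
  rewrite IH, H; auto.
Qed.

Lemma prodC_mult (n : nat) (f g : nat -> C) :
  prodC n (fun i => f i * g i) = prodC n f * prodC n g.
Proof. induction n as [|n IH]; simpl; [ring | rewrite IH; ring]. Qed.

Lemma prodC_neq_0 (n : nat) (f : nat -> C) :
  (forall i, (i < n)%nat -> f i <> 0) -> prodC n f <> 0.
Proof.
  induction n as [|n IH]; intros H; simpl.
  - apply C1_nz.
  - apply Cmult_neq_0; auto.
Qed.

Lemma sumC_ext (n : nat) (f g : nat -> C) :
  (forall i, (i < n)%nat -> f i = g i) -> sumC n f = sumC n g.
Proof.
  induction n as [|n IH]; intros H; simpl; auto.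
  rewrite IH, H; auto.
Qed.

Lemma sumZ_ext (M : nat) (f g : Z -> C) :
  (forall m, f m = g m) -> sumZ M f = sumZ M g.
Proof. intros H. apply sumC_ext; auto. Qed.

Lemma sumC_lin (n : nat) (c d : C) (f g : nat -> C) :
  sumC n (fun i => c * f i + d * g i) = c * sumC n f + d * sumC n g.
Proof. induction n as [|n IH]; simpl; [ring | rewrite IH; ring]. Qed.

Lemma sumZ_lin (M : nat) (c d : C) (f g : Z -> C) :
  sumZ M (fun i => c * f i + d * g i) = c * sumZ M f + d * sumZ M g.
Proof. apply (sumC_lin _ c d (fun i => f _) (fun i => g _)). Qed.

Lemma sumZ_scal (M : nat) (c : C) (f : Z -> C) :
  sumZ M (fun m => c * f m) = c * sumZ M f.
Proof.
  transitivity (sumZ M (fun m => c * f m + 0 * f m)).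
  - apply sumZ_ext; intros; ring.
  - rewrite sumZ_lin; ring.
Qed.

Lemma sumZ_telescope (M : nat) (f : Z -> C) :
  sumZ M (fun m => f (m + 1)%Z - f m) = f (Z.of_nat M + 1)%Z - f (- Z.of_nat M)%Z.
Proof.
  assert (H : forall k, sumC k (fun i => f (Z.of_nat i - Z.of_nat M + 1)%Z
      - f (Z.of_nat i - Z.of_nat M)%Z)
    = f (Z.of_nat k - Z.of_nat M)%Z - f (- Z.of_nat M)%Z).
  { induction k as [|k IH]; cbn [sumC].
    - replace (Z.of_nat 0 - Z.of_nat M)%Z with (- Z.of_nat M)%Z by lia. ring.
    - rewrite IH.
      replace (Z.of_nat (S k) - Z.of_nat M)%Z with (Z.of_nat k - Z.of_nat M + 1)%Z by lia.
      ring. }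
  unfold sumZ. rewrite H. f_equal. f_equal. lia.
Qed.

Lemma sumZ_support (K M : nat) (f : Z -> C) :
  (forall m, (Z.of_nat K < Z.abs m)%Z -> f m = 0) -> (K <= M)%nat -> sumZ M f = sumZ K f.
Proof.
  intros H HM. induction HM as [|M HM IH]; auto.
  rewrite <- IH. unfold sumZ.
  replace (2 * S M + 1)%nat with (S (S (2 * M + 1))) by lia.
  assert (Hs : forall k (u : nat -> C), sumC (S k) u = u 0%nat + sumC k (fun i => u (S i))).
  { induction k as [|k IHk]; intros u; [simpl; ring|].
    change (sumC (S (S k)) u) with (sumC (S k) u + u (S k)).
    rewrite IHk. simpl. ring. }
  rewrite Hs. cbn [sumC].
  rewrite (H (Z.of_nat 0 - Z.of_nat (S M))%Z) by lia.
  rewrite (H (Z.of_nat (S (2 * M + 1)) - Z.of_nat (S M))%Z) by lia.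
  rewrite Cplus_0_l, Cplus_0_r. apply sumC_ext. intros i _. f_equal. lia.
Qed.

(** * Pochhammer symbols and their shifts *)

Lemma poch_nat (b : C) (k : nat) :
  poch b (Z.of_nat k) = prodC k (fun i => b + RtoC (INR i)).
Proof.
  destruct k as [|k]; [reflexivity|].
  change (Z.of_nat (S k)) with (Zpos (Pos.of_succ_nat k)).
  unfold poch. now rewrite SuccNat2Pos.id_succ.
Qed.

Lemma poch_neg (b : C) (k : nat) :
  poch b (- Z.of_nat k) = / prodC k (fun i => b - RtoC (INR (S i))).
Proof.
  destruct k as [|k].
  - simpl. field.
  - change (- Z.of_nat (S k))%Z with (Zneg (Pos.of_succ_nat k)).
    unfold poch. now rewrite SuccNat2Pos.id_succ.
Qed.

(** For [n < 0] the factor [b + n] sits in the denominator of [poch b n]. Where it vanishes the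
    right-hand side is 0 by convention while [poch b (n + 1)] can be nonzero, whence the
    alternative. *)
Lemma poch_succ (b : C) (n : Z) :
  (0 <= n)%Z \/ b + RtoC (IZR n) <> 0 ->
  poch b (n + 1) = (b + RtoC (IZR n)) * poch b n.
Proof.
  intros H. destruct (Z_le_gt_dec 0 n) as [Hn|Hn].
  - rewrite <- (Z2Nat.id n) by auto. set (k := Z.to_nat n).
    replace (Z.of_nat k + 1)%Z with (Z.of_nat (S k)) by lia.
    rewrite !poch_nat. cbn [prodC]. rewrite <- INR_IZR_INZ. ring.
  - destruct H as [H|H]; [lia|].
    set (k := Z.to_nat (- n - 1)).
    assert (En : n = (- Z.of_nat (S k))%Z) by lia.
    replace (n + 1)%Z with (- Z.of_nat k)%Z by lia.
    rewrite En in *. rewrite !poch_neg. cbn [prodC].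
    rewrite opp_IZR, <- INR_IZR_INZ, RtoC_opp in *.
    change (b - RtoC (INR (S k))) with (b + - RtoC (INR (S k))).
    rewrite Cinv_mult. set (P := / prodC _ _).
    transitivity ((b + - RtoC (INR (S k))) * / (b + - RtoC (INR (S k))) * P); [|ring].
    rewrite Cinv_r by exact H. ring.
Qed.

(* [gam x s = Gamma((x+s)/2) / Gamma(1+(x-s)/2)]; the plus- and minus-sign factors are
   [gam (a_k + y) (N_k + N)] and [gam (a_k - y) (N_k - N)]. *)
Definition gam (x : C) (s : Z) : C := poch (1 + (x - RtoC (IZR s)) / 2) (s - 1).

(** Raising [x] and [s] together fixes the base [1 + (x - s)/2] and moves only the index. All
    parameter shifts rest on this rule. *)
Lemma gam_succ (x : C) (s : Z) :
  (0 < s)%Z \/ x + RtoC (IZR s) <> 0 ->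
  gam (x + 1) (s + 1) = (x + RtoC (IZR s)) / 2 * gam x s.
Proof.
  intros H. unfold gam.
  replace (s + 1 - 1)%Z with (s - 1 + 1)%Z by lia.
  replace (1 + (x + 1 - RtoC (IZR (s + 1))) / 2) with (1 + (x - RtoC (IZR s)) / 2)
    by (push_IZR; field).
  assert (E : 1 + (x - RtoC (IZR s)) / 2 + RtoC (IZR (s - 1)) = (x + RtoC (IZR s)) / 2)
    by (push_IZR; field).
  rewrite poch_succ.
  - now rewrite E.
  - destruct H as [H|H]; [left; lia|right]. rewrite E.
    intros H0. apply H. replace (x + RtoC (IZR s)) with ((x + RtoC (IZR s)) / 2 * 2)
      by (field). rewrite H0. ring.
Qed.

(** * Divided differences *)

Definition lprod (l : list C) (y : C) : C := fold_right (fun p r => (y - p) * r) 1 l.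

(* For distinct nodes, [dd U h] is the sum over [U] of the residues of
   [h y / lprod U y]. *)
Fixpoint dd (U : list C) (h : C -> C) : C :=
  match U with
  | nil => 0
  | p :: U' => h p / lprod U' p + dd U' (fun y => h y / (y - p))
  end.

Lemma lprod_app (l l' : list C) (y : C) : lprod (l ++ l') y = lprod l y * lprod l' y.
Proof. induction l as [|p l IH]; simpl; [ring | rewrite IH; ring]. Qed.

Lemma lprod_perm (l l' : list C) (y : C) : Permutation l l' -> lprod l y = lprod l' y.
Proof.
  induction 1 as [|p l l' _ IH|p q l|l1 l2 l3 _ IH1 _ IH2]; simpl.
  - reflexivity.
  - now rewrite IH.
  - ring.
  - congruence.
Qed.

Lemma lprod_neq_0 (l : list C) (y : C) : ~ In y l -> lprod l y <> 0.
Proof.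
  induction l as [|p l IH]; simpl; intros H.
  - apply C1_nz.
  - apply Cmult_neq_0; [apply Csub_neq_0|]; intuition.
Qed.

Lemma dd_ext (U : list C) : forall h h' : C -> C,
  (forall p, In p U -> h p = h' p) -> dd U h = dd U h'.
Proof.
  induction U as [|p U IH]; intros h h' H; simpl; auto.
  rewrite (H p) by (simpl; auto). f_equal.
  apply IH. intros q Hq. rewrite (H q); simpl; auto.
Qed.

Lemma dd_lin (c d : C) (U : list C) : forall h h' : C -> C,
  dd U (fun y => c * h y + d * h' y) = c * dd U h + d * dd U h'.
Proof.
  induction U as [|p U IH]; intros h h'; simpl; [ring|].
  rewrite (dd_ext U _ (fun y => c * (h y / (y - p)) + d * (h' y / (y - p)))).
  - rewrite IH. unfold Cdiv. ring.
  - intros q _. unfold Cdiv. ring.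
Qed.

Lemma dd_scal (c : C) (U : list C) (h : C -> C) :
  dd U (fun y => c * h y) = c * dd U h.
Proof.
  rewrite (dd_ext U _ (fun y => c * h y + 0 * h y)) by (intros; ring).
  rewrite dd_lin. ring.
Qed.

Lemma dd_perm (U U' : list C) : Permutation U U' -> forall h, dd U h = dd U' h.
Proof.
  induction 1 as [|p l l' Hp IH|p q l|l1 l2 l3 _ IH1 _ IH2]; intros h; simpl.
  - reflexivity.
  - now rewrite IH, (lprod_perm l l').
  - rewrite (dd_ext l _ (fun y => h y / (y - p) / (y - q)))
      by (intros; unfold Cdiv; ring).
    unfold Cdiv. rewrite !Cinv_mult. ring.
  - congruence.
Qed.

Lemma dd_cancel (p : C) (U : list C) (h : C -> C) :
  ~ In p U -> dd (p :: U) (fun y => (y - p) * h y) = dd U h.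
Proof.
  intros H. simpl. replace ((p - p) * h p / lprod U p) with (RtoC 0) by (unfold Cdiv; ring).
  rewrite Cplus_0_l. apply dd_ext. intros q Hq. field.
  apply Csub_neq_0. congruence.
Qed.

(** Write [y - z = (y - p) + (p - z)]; the first summand cancels the node [p]. *)
Lemma dd_mul_linear (p z : C) (U : list C) (h : C -> C) : ~ In p U ->
  dd (p :: U) (fun y => (y - z) * h y) = dd U h + (p - z) * dd (p :: U) h.
Proof.
  intros H. rewrite <- (dd_cancel p U h H).
  rewrite (dd_ext _ _ (fun y => 1 * ((y - p) * h y) + (p - z) * h y)) by (intros; ring).
  rewrite dd_lin. ring.
Qed.

Lemma dd_translate (c : C) (U : list C) : forall h : C -> C,
  dd (map (fun p => p + c) U) h = dd U (fun y => h (y + c)).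
Proof.
  induction U as [|p U IH]; intros h; simpl; auto.
  rewrite IH. f_equal.
  - f_equal. clear. induction U as [|q U IH]; simpl; auto. rewrite IH. ring.
  - apply dd_ext. intros q _. f_equal. ring.
Qed.

(** The splitting [p - q = (y - q) - (y - p)] gives the usual recursion for divided differences; it
    ends at two nodes, with the difference [c - c]. *)
Lemma dd_cst (c : C) (U : list C) :
  NoDup U -> (2 <= length U)%nat -> dd U (fun _ => c) = 0.
Proof.
  remember (length U) as k eqn:Ek. revert U Ek.
  induction k as [k IH] using lt_wf_ind. intros U Ek HU Hk.
  destruct U as [|p [|q U]]; simpl in Ek; try lia.
  inversion_clear HU as [|? ? Hp HU']. inversion_clear HU' as [|? ? Hq HU''].
  assert (Hpq : p <> q) by (intros ->; apply Hp; simpl; auto).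
  assert (Hp' : ~ In p U) by (intros ?; apply Hp; simpl; auto).
  assert (E : (p - q) * dd (p :: q :: U) (fun _ => c)
    = dd (p :: U) (fun _ => c) - dd (q :: U) (fun _ => c)).
  { rewrite <- (dd_cancel p (q :: U)) by auto.
    rewrite <- (dd_cancel q (p :: U)) by (simpl; intuition).
    rewrite (dd_perm (q :: p :: U) (p :: q :: U)) by apply perm_swap.
    rewrite <- dd_scal.
    rewrite (dd_ext _ _ (fun y => 1 * ((y - q) * c) + - (1) * ((y - p) * c))) by (intros; ring).
    rewrite dd_lin. ring. }
  assert (E0 : (p - q) * dd (p :: q :: U) (fun _ => c) = 0).
  { rewrite E. destruct U as [|r U].
    - simpl. field.
    - rewrite (IH (length (p :: r :: U))), (IH (length (q :: r :: U)));
        simpl in *; try lia; try (constructor; auto). ring. }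
  replace (dd (p :: q :: U) (fun _ => c))
    with (/ (p - q) * ((p - q) * dd (p :: q :: U) (fun _ => c)))
    by (field; apply Csub_neq_0; auto).
  rewrite E0. ring.
Qed.

(* Polynomials of degree at most [d] have this property, which is all that is needed of them. *)
Definition dd_degree_le (d : nat) (f : C -> C) : Prop :=
  forall U, NoDup U -> (d + 2 <= length U)%nat -> dd U f = 0.

Lemma dd_degree_cst (c : C) : dd_degree_le 0 (fun _ => c).
Proof. intros U HU H. apply dd_cst; auto. Qed.

Lemma dd_degree_mul (d : nat) (c z : C) (f : C -> C) :
  dd_degree_le d f -> dd_degree_le (S d) (fun y => f y * (c * (y - z))).
Proof.
  intros Hf U HU HL. destruct U as [|p U]; simpl in HL; [lia|].
  pose proof HU as HU0. inversion_clear HU as [|? ? Hp HU'].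
  rewrite (dd_ext _ _ (fun y => c * ((y - z) * f y))) by (intros; ring).
  rewrite dd_scal, dd_mul_linear by auto.
  rewrite (Hf U), (Hf (p :: U)); auto; simpl; try lia. ring.
Qed.

Lemma dd_degree_ext (d d' : nat) (f g : C -> C) :
  dd_degree_le d f -> (d <= d')%nat -> (forall y, f y = g y) -> dd_degree_le d' g.
Proof.
  intros Hf Hd E U HU HL. rewrite <- (Hf U HU) by lia. apply dd_ext. auto.
Qed.

Lemma dd_degree_prodC (k d : nat) (c : C) (z : nat -> C) (f : C -> C) :
  dd_degree_le d f -> dd_degree_le (k + d) (fun y => f y * prodC k (fun i => c * (y - z i))).
Proof.
  intros Hf. induction k as [|k IH]; simpl.
  - apply (dd_degree_ext d d f); auto. intros; ring.
  - apply (dd_degree_ext (S (k + d)) _ (fun y => f y * prodC k (fun i => c * (y - z i))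
      * (c * (y - z k)))); [apply dd_degree_mul; auto|lia|intros; ring].
Qed.

(** * The residue sum for generic parameters *)

(** The poles of [y |-> gam (x + y) s]. There are [1 - s] of them for [s <= 0], and truncation by
    [Z.to_nat] makes the list empty otherwise. *)
Definition Upl (x : C) (s : Z) : list C :=
  map (fun i => - x + RtoC (IZR (s + 2 * Z.of_nat i))) (seq 0 (Z.to_nat (1 - s))).

(** What is left of [gam (x + y) s] after multiplication by [lprod (Upl x s) y]: a polynomial in
    [y], hence meaningful at the poles too. *)
Definition regpl (x : C) (s : Z) (y : C) : C :=
  if (s <=? 0)%Z then RtoC 2 ^ Z.to_nat (1 - s) else gam (x + y) s.

Lemma Upl_nil (x : C) (s : Z) : (0 < s)%Z -> Upl x s = nil.
Proof. intros H. unfold Upl. replace (Z.to_nat (1 - s)) with 0%nat by lia. reflexivity. Qed.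

Lemma Upl_snd (x : C) (s : Z) (p : C) : In p (Upl x s) -> snd p = (- snd x)%R.
Proof.
  intros H. apply in_map_iff in H. destruct H as (i & <- & _). simpl. ring.
Qed.

Lemma Upl_NoDup (x : C) (s : Z) : NoDup (Upl x s).
Proof.
  apply FinFun.Injective_map_NoDup; [|apply seq_NoDup].
  intros i j H.
  assert (E : RtoC (IZR (s + 2 * Z.of_nat i)) = RtoC (IZR (s + 2 * Z.of_nat j))).
  { transitivity (- x + RtoC (IZR (s + 2 * Z.of_nat i)) + x); [ring|]. rewrite H. ring. }
  apply RtoC_inj in E.
  apply eq_IZR in E. lia.
Qed.

(** The progression starts at [- x + s], which does not change; it only loses its last point
    [- x - s]. *)
Lemma Upl_succ (x : C) (s : Z) : (s <= 0)%Z ->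
  Upl x s = Upl (x + 1) (s + 1) ++ (- x - RtoC (IZR s)) :: nil.
Proof.
  intros H. unfold Upl.
  replace (Z.to_nat (1 - s)) with (S (Z.to_nat (1 - (s + 1)))) by lia.
  rewrite seq_S, map_app. f_equal.
  - apply map_ext. intros i. push_IZR. ring.
  - cbn [map]. f_equal.
    replace (s + 2 * Z.of_nat (0 + Z.to_nat (1 - (s + 1))))%Z with (- s)%Z by lia.
    push_IZR. ring.
Qed.

Lemma Upl_translate (x : C) (s : Z) : Upl (x + 1) s = map (fun p => p + - (1)) (Upl x s).
Proof. unfold Upl. rewrite map_map. apply map_ext. intros i. ring. Qed.

Lemma regpl_le_1 (x : C) (s : Z) (y : C) : (s <= 1)%Z -> regpl x s y = RtoC 2 ^ Z.to_nat (1 - s).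
Proof.
  intros H. unfold regpl. destruct (Z.leb_spec s 0); auto.
  replace s with 1%Z by lia. reflexivity.
Qed.

Lemma regpl_translate (x : C) (s : Z) (y : C) : regpl (x + 1) s (y + - (1)) = regpl x s y.
Proof.
  unfold regpl. destruct (s <=? 0)%Z; auto. f_equal. ring.
Qed.

(** The residue form of [gam_succ]. The factor [gam (x + y) s] is singular at its own nodes, so for
    [s <= 0] the rule acts on the node list: the linear factor cancels the pole [- x - s], and the
    division by 2 matches the power of 2 in [regpl]. For [s > 0] there is no pole and [gam_succ]
    applies directly. *)
Lemma dd_Upl_succ (A : list C) (x : C) (s : Z) (h : C -> C) :
  NoDup (Upl x s ++ A) ->
  dd (Upl x s ++ A) (fun y => h y * ((x + y + RtoC (IZR s)) / 2 * regpl x s y)) =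
  dd (Upl (x + 1) (s + 1) ++ A) (fun y => h y * regpl (x + 1) (s + 1) y).
Proof.
  intros HN. destruct (Z_le_gt_dec s 0) as [Hs|Hs].
  - rewrite Upl_succ in * by auto. rewrite <- app_assoc in *. simpl in *.
    rewrite (dd_perm _ _ (Permutation_sym (Permutation_middle _ _ _))).
    rewrite <- (dd_cancel (- x - RtoC (IZR s)) (Upl (x + 1) (s + 1) ++ A)).
    + apply dd_ext. intros y _. rewrite !regpl_le_1 by lia.
      replace (Z.to_nat (1 - s)) with (S (Z.to_nat (1 - (s + 1)))) by lia.
      rewrite Cpow_S. field.
    + apply NoDup_remove_2 in HN. exact HN.
  - rewrite !Upl_nil by lia. apply dd_ext. intros y _. unfold regpl.
    destruct (Z.leb_spec s 0); [lia|]. destruct (Z.leb_spec (s + 1) 0); [lia|].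
    replace (x + 1 + y) with (x + y + 1) by ring.
    rewrite gam_succ by (left; lia). ring.
Qed.

Definition bumpC (e : nat -> bool) (a : nat -> C) (k : nat) : C := if e k then a k + 1 else a k.
Definition bumpZ (e : nat -> bool) (n : nat -> Z) (k : nat) : Z :=
  if e k then (n k + 1)%Z else n k.

Definition nodes (a : nat -> C) (s : nat -> Z) (ks : list nat) : list C :=
  flat_map (fun k => Upl (a k) (s k)) ks.

Definition prodL (ks : list nat) (f : nat -> C) : C := fold_right (fun k r => f k * r) 1 ks.

(** [e] selects the indices that move. [A] accumulates the nodes of the indices already treated, so
    that the induction shifts one index at a time. *)
Lemma dd_nodes_bump (e : nat -> bool) (a : nat -> C) (s : nat -> Z) (ks : list nat) :
  forall (A : list C) (h : C -> C), NoDup (A ++ nodes a s ks) ->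
  dd (A ++ nodes a s ks) (fun y => h y * prodL ks (fun k =>
    (if e k then (a k + y + RtoC (IZR (s k))) / 2 else 1) * regpl (a k) (s k) y)) =
  dd (A ++ nodes (bumpC e a) (bumpZ e s) ks) (fun y => h y * prodL ks (fun k =>
    regpl (bumpC e a k) (bumpZ e s k) y)).
Proof.
  induction ks as [|k ks IH]; intros A h HN; [reflexivity|].
  cbn [nodes flat_map prodL fold_right] in *.
  fold (nodes a s ks) in *. fold (nodes (bumpC e a) (bumpZ e s) ks) in *.
  set (W := nodes (bumpC e a) (bumpZ e s) ks) in *.
  assert (P1 : Permutation (A ++ Upl (a k) (s k) ++ nodes a s ks)
                           (Upl (a k) (s k) ++ A ++ nodes a s ks)).
  { rewrite !app_assoc. apply Permutation_app_tail, Permutation_app_comm. }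
  assert (P2 : Permutation (A ++ Upl (bumpC e a k) (bumpZ e s k) ++ W)
                           ((Upl (bumpC e a k) (bumpZ e s k) ++ A) ++ W)).
  { rewrite !app_assoc. apply Permutation_app_tail, Permutation_app_comm. }
  rewrite (dd_perm _ _ P1), (dd_perm _ _ P2).
  apply (Permutation_NoDup P1) in HN.
  set (h' := fun y => h y * prodL ks (fun k =>
    (if e k then (a k + y + RtoC (IZR (s k))) / 2 else 1) * regpl (a k) (s k) y)).
  transitivity (dd ((Upl (bumpC e a k) (bumpZ e s k) ++ A) ++ nodes a s ks)
    (fun y => h' y * regpl (bumpC e a k) (bumpZ e s k) y)).
  - rewrite <- app_assoc. unfold bumpC, bumpZ. destruct (e k).
    + rewrite <- dd_Upl_succ by exact HN. apply dd_ext. intros y _. unfold h', prodL. ring.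
    + apply dd_ext. intros y _. unfold h', prodL. ring.
  - assert (HN' : NoDup ((Upl (bumpC e a k) (bumpZ e s k) ++ A) ++ nodes a s ks)).
    { rewrite <- app_assoc. unfold bumpC, bumpZ. destruct (e k); auto.
      destruct (Z_le_gt_dec (s k) 0) as [Hs|Hs].
      - rewrite Upl_succ in HN by auto. rewrite <- app_assoc in HN.
        now apply NoDup_remove_1 in HN.
      - rewrite Upl_nil in * by lia. exact HN. }
    specialize (IH _ (fun y => h y * regpl (bumpC e a k) (bumpZ e s k) y) HN').
    rewrite (dd_ext _ (fun y => h' y * regpl (bumpC e a k) (bumpZ e s k) y)
      (fun y => h y * regpl (bumpC e a k) (bumpZ e s k) y * prodL ks (fun k =>
      (if e k then (a k + y + RtoC (IZR (s k))) / 2 else 1) * regpl (a k) (s k) y))).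
    + rewrite IH. apply dd_ext. intros y _. unfold prodL. ring.
    + intros y _. unfold h'. ring.
Qed.

(* The only consequences of genericity that are used; since shifting the [a k] by integers does
   not affect them, they survive the parameter shifts. *)
Definition generic (a : nat -> C) : Prop :=
  (forall j k, (j < 6)%nat -> (k < 6)%nat -> (snd (a j) + snd (a k) <> 0)%R) /\
  (forall j k, (j < 6)%nat -> (k < 6)%nat -> j <> k -> snd (a j) <> snd (a k)).

Lemma generic_same_snd (a b : nat -> C) :
  (forall k, snd (b k) = snd (a k)) -> generic a -> generic b.
Proof. intros E [H1 H2]. split; intros; rewrite !E; auto. Qed.

Lemma nodes_snd (a : nat -> C) (s : nat -> Z) (ks : list nat) (y : C) :
  In y (nodes a s ks) -> exists k, In k ks /\ snd y = (- snd (a k))%R.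
Proof.
  intros H. apply in_flat_map in H. destruct H as (k & Hk & Hy).
  exists k. split; auto. now apply Upl_snd in Hy.
Qed.

(** The nodes of index [k] lie on the horizontal line [Im y = - Im a_k], and these lines are
    distinct. *)
Lemma nodes_NoDup (a : nat -> C) (s : nat -> Z) (ks : list nat) : NoDup ks ->
  (forall j k, In j ks -> In k ks -> j <> k -> snd (a j) <> snd (a k)) ->
  NoDup (nodes a s ks).
Proof.
  induction 1 as [|k ks Hk HN IH]; intros H; simpl; [constructor|].
  apply NoDup_app; [apply Upl_NoDup|apply IH; intros; apply H; simpl; auto|].
  intros y Hy Hy'. apply Upl_snd in Hy. apply nodes_snd in Hy'.
  destruct Hy' as (j & Hj & Hy').
  apply (H k j); simpl; auto; [intros ->; auto|]. lra.
Qed.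

Lemma generic_nodes_NoDup (a : nat -> C) (s : nat -> Z) :
  generic a -> NoDup (nodes a s (seq 0 6)).
Proof.
  intros [_ H]. apply nodes_NoDup; [apply seq_NoDup|].
  intros j k Hj Hk. apply in_seq in Hj, Hk. apply H; lia.
Qed.

Lemma prodL_seq6 (f : nat -> C) : prodL (seq 0 6) f = prodC 6 f.
Proof. simpl. ring. Qed.

(** * Parameter shifts and translation of the residue sum *)

Definition plidx (n : nat -> Z) (h m : Z) (k : nat) : Z := (n k + m + h)%Z.

(* Sum of the residues of [P y * prod_k gam (a_k + y) (N_k + N) * gam (a_k - y) (N_k - N)]
   at the poles of the plus-sign factors. *)
Definition Lam (a : nat -> C) (n : nat -> Z) (h m : Z) (P : C -> C) : C :=
  dd (nodes a (plidx n h m) (seq 0 6)) (fun y => P y *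
    prodC 6 (fun k => regpl (a k) (plidx n h m k) y * gam (a k - y) (n k - m))).

Lemma Lam_lin (a : nat -> C) (n : nat -> Z) (h m : Z) (c d : C) (P Q : C -> C) :
  Lam a n h m (fun y => c * P y + d * Q y) = c * Lam a n h m P + d * Lam a n h m Q.
Proof. unfold Lam. rewrite <- dd_lin. apply dd_ext. intros. ring. Qed.

Lemma Lam_ext (a : nat -> C) (n : nat -> Z) (h m : Z) (P Q : C -> C) :
  (forall y, P y = Q y) -> Lam a n h m P = Lam a n h m Q.
Proof. intros H. apply dd_ext. intros. now rewrite H. Qed.

Definition plf (a : nat -> C) (n : nat -> Z) (h m : Z) (k : nat) (y : C) : C :=
  (a k + y + RtoC (IZR (plidx n h m k))) / 2.
Definition mif (a : nat -> C) (n : nat -> Z) (m : Z) (k : nat) (y : C) : C :=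
  (a k - y + RtoC (IZR (n k - m))) / 2.

(** The imaginary part is [Im a_k + Im a_j] for some [j], nonzero by genericity even when [j = k].
    This lets [gam_succ] act on the minus-sign factors at every node. *)
Lemma generic_minus_neq_0 (a : nat -> C) (s : nat -> Z) (k : nat) (y : C) (r : R) :
  generic a -> (k < 6)%nat -> In y (nodes a s (seq 0 6)) -> a k - y + RtoC r <> 0.
Proof.
  intros [H _] Hk Hy. apply nodes_snd in Hy. destruct Hy as (j & Hj & Hy).
  apply in_seq in Hj. apply C_neq_snd. simpl. rewrite Hy.
  specialize (H k j Hk ltac:(lia)). lra.
Qed.

Lemma Lam_bump (e : nat -> bool) (a : nat -> C) (n : nat -> Z) (h m : Z) (P : C -> C) :
  generic a ->
  Lam (bumpC e a) (bumpZ e n) h m P =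
  Lam a n h m (fun y => P y * prodC 6 (fun k => if e k then plf a n h m k y * mif a n m k y else 1)).
Proof.
  intros Ha. symmetry.
  assert (Es : plidx (bumpZ e n) h m = bumpZ e (plidx n h m)).
  { apply functional_extensionality. intros k. unfold plidx, bumpZ. destruct (e k); lia. }
  unfold Lam. rewrite Es.
  set (s := plidx n h m).
  pose proof (dd_nodes_bump e a s (seq 0 6) nil
    (fun y => P y * prodC 6 (fun k => gam (bumpC e a k - y) (bumpZ e n k - m)))
    (generic_nodes_NoDup a s Ha)) as H.
  rewrite !app_nil_l in H.
  transitivity (dd (nodes (bumpC e a) (bumpZ e s) (seq 0 6)) (fun y =>
    P y * prodC 6 (fun k => gam (bumpC e a k - y) (bumpZ e n k - m)) *
    prodL (seq 0 6) (fun k => regpl (bumpC e a k) (bumpZ e s k) y))).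
  - rewrite <- H. apply dd_ext. intros y Hy. rewrite prodL_seq6.
    rewrite <- !Cmult_assoc. f_equal. rewrite <- !prodC_mult. apply prodC_ext.
    intros k Hk. unfold bumpC, bumpZ. destruct (e k).
    + replace (a k + 1 - y) with (a k - y + 1) by ring.
      replace (n k + 1 - m)%Z with (n k - m + 1)%Z by lia.
      rewrite gam_succ by (right; apply (generic_minus_neq_0 a s); auto).
      unfold plf, mif. fold s. ring.
    + ring.
  - apply dd_ext. intros y _. rewrite prodL_seq6, <- Cmult_assoc, <- prodC_mult.
    f_equal. apply prodC_ext. intros; ring.
Qed.

(** Multiplying by all [plf] turns the plus-sign factors into those at [(y+1, N+1)]. In the
    minus-sign factors the same substitution releases all the factors [mif]. *)
Lemma Lam_translate (a : nat -> C) (n : nat -> Z) (h m : Z) (P : C -> C) : generic a ->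
  Lam a n h m (fun y => P y * prodC 6 (fun k => plf a n h m k y)) =
  Lam a n h (m + 1) (fun y => P (y + - (1)) * prodC 6 (fun k => mif a n (m + 1) k y)).
Proof.
  intros Ha. unfold Lam. set (s := plidx n h m). set (e := fun _ : nat => true).
  pose proof (dd_nodes_bump e a s (seq 0 6) nil
    (fun y => P y * prodC 6 (fun k => gam (a k - y) (n k - m)))
    (generic_nodes_NoDup a s Ha)) as H.
  rewrite !app_nil_l in H.
  assert (En : nodes (bumpC e a) (bumpZ e s) (seq 0 6) =
    map (fun p => p + - (1)) (nodes a (plidx n h (m + 1)) (seq 0 6))).
  { unfold nodes. rewrite !flat_map_concat_map, concat_map, map_map. f_equal.
    apply map_ext. intros k. unfold bumpC, bumpZ, e. rewrite Upl_translate.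
    f_equal. f_equal. unfold s, plidx. lia. }
  transitivity (dd (nodes (bumpC e a) (bumpZ e s) (seq 0 6)) (fun y =>
    P y * prodC 6 (fun k => gam (a k - y) (n k - m)) *
    prodL (seq 0 6) (fun k => regpl (bumpC e a k) (bumpZ e s k) y))).
  - rewrite <- H. apply dd_ext. intros y _. rewrite prodL_seq6.
    rewrite <- !Cmult_assoc. f_equal. rewrite <- !prodC_mult. apply prodC_ext.
    intros k _. unfold plf, e. fold s. ring.
  - rewrite En, dd_translate. apply dd_ext. intros y Hy. rewrite prodL_seq6.
    rewrite <- !Cmult_assoc. f_equal. rewrite <- !prodC_mult. apply prodC_ext.
    intros k Hk. unfold bumpC, bumpZ, e. rewrite regpl_translate.
    replace (s k + 1)%Z with (plidx n h (m + 1) k) by (unfold s, plidx; lia).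
    replace (a k - (y + - (1))) with (a k - y + 1) by ring.
    replace (n k - m)%Z with (n k - (m + 1) + 1)%Z by lia.
    rewrite gam_succ by (right; apply (generic_minus_neq_0 a (plidx n h (m + 1))); auto).
    unfold mif. ring.
Qed.

(** * Vanishing of the residue sum for large |N| *)

Lemma Lam_high (a : nat -> C) (n : nat -> Z) (h m : Z) (P : C -> C) :
  (forall k, (k < 6)%nat -> (0 < plidx n h m k)%Z) -> Lam a n h m P = 0.
Proof.
  intros H. unfold Lam.
  replace (nodes a (plidx n h m) (seq 0 6)) with (@nil C); [reflexivity|].
  unfold nodes. simpl. rewrite !Upl_nil by (apply H; lia). reflexivity.
Qed.

Lemma dd_degree_gam (d : nat) (f : C -> C) (x : C) (s : Z) : (0 < s)%Z ->
  dd_degree_le d f -> dd_degree_le (Z.to_nat (s - 1) + d) (fun y => f y * gam (x - y) s).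
Proof.
  intros Hs Hf.
  apply (dd_degree_ext _ _ _ _ (dd_degree_prodC (Z.to_nat (s - 1)) d (- / 2)
    (fun i => x - RtoC (IZR s) + 2 + 2 * RtoC (INR i)) f Hf)); [lia|].
  intros y. unfold gam. rewrite <- (Z2Nat.id (s - 1)) at 2 by lia. rewrite poch_nat.
  f_equal. apply prodC_ext. intros i _. field.
Qed.

Lemma nodes_length (a : nat -> C) (s : nat -> Z) (ks : list nat) :
  length (nodes a s ks) = fold_right (fun k l => (Z.to_nat (1 - s k) + l)%nat) 0%nat ks.
Proof.
  induction ks as [|k ks IH]; [reflexivity|]. simpl.
  rewrite length_app, IH. unfold Upl. now rewrite length_map, length_seq.
Qed.

Definition sum6 (n : nat -> Z) : Z :=
  (n 0%nat + n 1%nat + n 2%nat + n 3%nat + n 4%nat + n 5%nat)%Z.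

(** Here every pole is a plus pole, so the residues of a rational function with enough decay add up
    to 0. The numerator has degree at most [d + sum (n_k - m - 1)], there are
    [sum (1 - n_k - m - h)] nodes, and the last inequality says that the latter exceeds the former
    by at least 2. *)
Lemma Lam_low (a : nat -> C) (n : nat -> Z) (h m : Z) (d : nat) (P : C -> C) :
  generic a -> dd_degree_le d P ->
  (forall k, (k < 6)%nat -> (0 < n k - m)%Z /\ (plidx n h m k <= 0)%Z) ->
  (Z.of_nat d + 2 * sum6 n + 6 * h <= 10)%Z ->
  Lam a n h m P = 0.
Proof.
  intros Ha HP H Hd. unfold Lam. set (s := plidx n h m) in *.
  set (c := prodC 6 (fun k => RtoC 2 ^ Z.to_nat (1 - s k))).
  rewrite (dd_ext _ _ (fun y => c * (P y * gam (a 0%nat - y) (n 0%nat - m)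
    * gam (a 1%nat - y) (n 1%nat - m) * gam (a 2%nat - y) (n 2%nat - m)
    * gam (a 3%nat - y) (n 3%nat - m) * gam (a 4%nat - y) (n 4%nat - m)
    * gam (a 5%nat - y) (n 5%nat - m)))).
  - rewrite dd_scal.
    match goal with |- c * dd _ ?f = _ =>
      assert (Hf : dd_degree_le (Z.to_nat (n 5%nat - m - 1) + (Z.to_nat (n 4%nat - m - 1)
        + (Z.to_nat (n 3%nat - m - 1) + (Z.to_nat (n 2%nat - m - 1)
        + (Z.to_nat (n 1%nat - m - 1) + (Z.to_nat (n 0%nat - m - 1) + d)))))) f) end.
    { repeat (apply dd_degree_gam; [apply H; lia|]). exact HP. }
    rewrite Hf; [ring|apply generic_nodes_NoDup; auto|].
    rewrite nodes_length. cbn [seq fold_right].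
    pose proof (H 0%nat ltac:(lia)). pose proof (H 1%nat ltac:(lia)).
    pose proof (H 2%nat ltac:(lia)). pose proof (H 3%nat ltac:(lia)).
    pose proof (H 4%nat ltac:(lia)). pose proof (H 5%nat ltac:(lia)).
    unfold s, plidx, sum6 in *. lia.
  - intros y _. rewrite prodC_mult.
    rewrite (prodC_ext 6 (fun i => regpl (a i) (s i) y) (fun k => RtoC 2 ^ Z.to_nat (1 - s k))).
    + fold c. cbn [prodC]. ring.
    + intros k Hk. apply regpl_le_1. specialize (H k Hk). lia.
Qed.

(** * The two-term relation *)

Definition Nc (h m : Z) : C := RtoC (IZR m) + RtoC (IZR h) / 2.

Definition Jm (a : nat -> C) (n : nat -> Z) (h m : Z) : C :=
  Lam a n h m (fun y => y * y - Nc h m * Nc h m).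

Definition al (a : nat -> C) (n : nat -> Z) (h : Z) (k : nat) : C :=
  (a k + RtoC (IZR (n k)) + RtoC (IZR h) / 2) / 2.

(** This product occurs twice: as an interpolation value in [telescoping_identity], and as the
    factor that the right-hand side gains when index [i] is shifted. The coincidence is why both
    sides obey the same recursion. *)
Definition Pfac (a : nat -> C) (n : nat -> Z) (h : Z) (i : nat) : C :=
  prodC 6 (fun j => if Nat.eqb j i then 1 else al a n h i + al a n h j).

(** Lagrange interpolation. The difference of products is odd in [u], and its coefficient of [u^5]
    is [2 sum x_k = 0], so divided by [2u] it is linear in [u^2]. At [u = x_i] the second product
    vanishes and the first is [2 x_i] times the product of [x_i + x_j] over [j <> i]; likewise at
    [x_5]. *)
Lemma telescoping_identity (x : nat -> C) (u : C) (i : nat) : (i < 5)%nat ->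
  sumC 6 x = 0 ->
  (x i * x i - x 5%nat * x 5%nat) *
    (prodC 6 (fun k => x k + u) - prodC 6 (fun k => x k - u)) =
  2 * u * (prodC 6 (fun j => if Nat.eqb j 5 then 1 else x 5%nat + x j) * (x i * x i - u * u)
    - prodC 6 (fun j => if Nat.eqb j i then 1 else x i + x j) * (x 5%nat * x 5%nat - u * u)).
Proof.
  intros Hi Hs. simpl sumC in Hs.
  assert (E : x 5%nat = - (x 0%nat + x 1%nat + x 2%nat + x 3%nat + x 4%nat)).
  { transitivity (0 + x 0%nat + x 1%nat + x 2%nat + x 3%nat + x 4%nat + x 5%nat
      - (x 0%nat + x 1%nat + x 2%nat + x 3%nat + x 4%nat)); [ring|]. rewrite Hs. ring. }
  do 5 (destruct i as [|i]; [cbn [prodC Nat.eqb]; rewrite E; ring|]). lia.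
Qed.

Lemma Jm_bump (a : nat -> C) (n : nat -> Z) (h m : Z) (i : nat) : generic a -> (i < 6)%nat ->
  Jm (bumpC (fun k => Nat.eqb k i) a) (bumpZ (fun k => Nat.eqb k i) n) h m =
  Lam a n h m (fun y => (y * y - Nc h m * Nc h m) *
    (al a n h i * al a n h i - (y + Nc h m) / 2 * ((y + Nc h m) / 2))).
Proof.
  intros Ha Hi. unfold Jm. rewrite Lam_bump by auto. apply Lam_ext. intros y. f_equal.
  transitivity (plf a n h m i y * mif a n m i y).
  - do 6 (destruct i as [|i]; [cbn [prodC Nat.eqb]; ring|]). lia.
  - unfold plf, mif, al, Nc, plidx. push_IZR. field.
Qed.

Definition idx_bounded (n : nat -> Z) (M : nat) : Prop :=
  forall k, (k < 6)%nat -> (Z.abs (n k) + 3 <= Z.of_nat M)%Z.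

(** The parameters are the intermediate ones, with [sum N_k = 1] and [sum a_k = -1]; the relation
    compares raising index [i] with raising index 5. *)
Lemma Jsum_step (a : nat -> C) (n : nat -> Z) (h : Z) (M i : nat) :
  generic a -> (0 <= h <= 1)%Z -> (2 * sum6 n + 6 * h = 2)%Z ->
  sumC 6 a = - (1) -> (i < 5)%nat -> idx_bounded n M ->
  Pfac a n h 5 * sumZ M (Jm (bumpC (fun k => Nat.eqb k i) a) (bumpZ (fun k => Nat.eqb k i) n) h) =
  Pfac a n h i * sumZ M (Jm (bumpC (fun k => Nat.eqb k 5) a) (bumpZ (fun k => Nat.eqb k 5) n) h).
Proof.
  intros Ha Hh Hn Hsa Hi HM.
  set (Y := fun m => Lam a n h m (fun y => (Nc h m - y) * prodC 6 (fun k => mif a n m k y))).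
  set (x := al a n h).
  assert (Hx : sumC 6 x = 0).
  { assert (E : (2 * RtoC (IZR (sum6 n)) + 6 * RtoC (IZR h) = 2)%C).
    { rewrite <- !RtoC_mult, <- RtoC_plus, <- !mult_IZR, <- plus_IZR. now rewrite Hn. }
    transitivity ((2 * sumC 6 a + (2 * RtoC (IZR (sum6 n)) + 6 * RtoC (IZR h))) / 4).
    - unfold x, al, sum6. cbn [sumC]. push_IZR. field.
    - rewrite E, Hsa. field. }
  (* [Nc h m - y] is [2u'], the quantity invariant under the translation. *)
  assert (HX : forall m, Y (m + 1)%Z =
    Lam a n h m (fun y => (Nc h m - y) * prodC 6 (fun k => plf a n h m k y))).
  { intros m. rewrite Lam_translate by auto. apply Lam_ext. intros y. f_equal.
    unfold Nc. push_IZR. field. }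
  assert (Hpt : forall m, (x i * x i - x 5%nat * x 5%nat) * (Y (m + 1)%Z - Y m) =
    - Pfac a n h 5 * Jm (bumpC (fun k => Nat.eqb k i) a) (bumpZ (fun k => Nat.eqb k i) n) h m
    + Pfac a n h i * Jm (bumpC (fun k => Nat.eqb k 5) a) (bumpZ (fun k => Nat.eqb k 5) n) h m).
  { intros m. rewrite HX, !Jm_bump by (auto; lia). unfold Y.
    rewrite <- Lam_lin.
    set (D := x i * x i - x 5%nat * x 5%nat).
    transitivity (D * Lam a n h m (fun y => (Nc h m - y) * prodC 6 (fun k => plf a n h m k y))
      + - D * Lam a n h m (fun y => (Nc h m - y) * prodC 6 (fun k => mif a n m k y))); [ring|].
    rewrite <- Lam_lin. apply Lam_ext. intros y.
    set (u := (y + Nc h m) / 2).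
    rewrite (prodC_ext 6 (fun k => plf a n h m k y) (fun k => x k + u))
      by (intros k _; unfold plf, x, al, u, plidx, Nc; push_IZR; field).
    rewrite (prodC_ext 6 (fun k => mif a n m k y) (fun k => x k - u))
      by (intros k _; unfold mif, x, al, u, plidx, Nc; push_IZR; field).
    transitivity ((Nc h m - y) * (D * (prodC 6 (fun k => x k + u) - prodC 6 (fun k => x k - u))));
      [ring|].
    unfold D. rewrite telescoping_identity by auto.
    fold (Pfac a n h 5). fold (Pfac a n h i). fold x.
    change (prodC 6 (fun j => if Nat.eqb j 5 then 1 else x 5%nat + x j)) with (Pfac a n h 5).
    change (prodC 6 (fun j => if Nat.eqb j i then 1 else x i + x j)) with (Pfac a n h i).
    (* Here the weight of [Jm] appears: [(N - y) * 2u = -(y^2 - N^2)]. *)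
    unfold u. field. }
  assert (HS : sumZ M (fun m => (x i * x i - x 5%nat * x 5%nat) * (Y (m + 1)%Z - Y m)) = 0).
  { rewrite (sumZ_scal M _ (fun m => Y (m + 1)%Z - Y m)), sumZ_telescope.
    replace (Y (Z.of_nat M + 1)%Z) with (RtoC 0).
    2:{ symmetry. apply Lam_high. intros k Hk. specialize (HM k Hk). unfold plidx. lia. }
    replace (Y (- Z.of_nat M)%Z) with (RtoC 0); [ring|].
    (* Degree 7 comes from the six factors [mif] and the factor [N - y]; the condition of [Lam_low]
       becomes [7 + 2 <= 10]. *)
    symmetry. apply (Lam_low a n h _ 7); auto.
    - apply (dd_degree_ext (6 + 1) _ (fun y => (1 * (- (1) * (y - Nc h (- Z.of_nat M))))
        * prodC 6 (fun k => - / 2 * (y - (a k + RtoC (IZR (n k - - Z.of_nat M))))))); [|lia|].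
      + apply dd_degree_prodC. apply dd_degree_mul. apply (dd_degree_cst 1).
      + intros y. f_equal; [ring|]. apply prodC_ext. intros k _. unfold mif. field.
    - intros k Hk. specialize (HM k Hk). unfold plidx. lia.
    - lia. }
  rewrite (sumZ_ext M _ _ Hpt), sumZ_lin in HS.
  match goal with |- ?l = ?r => transitivity (r - 0); [|ring]; rewrite <- HS; ring end.
Qed.

Definition Rp (a : nat -> C) (n : nat -> Z) (h : Z) : C :=
  prodC 6 (fun k => prodC k (fun j => gam (a j + a k) (n j + n k + h))).

Lemma al_plus (a : nat -> C) (n : nat -> Z) (h : Z) (j k : nat) :
  al a n h j + al a n h k = (a j + a k + RtoC (IZR (n j + n k + h))) / 2.
Proof. unfold al. push_IZR. field. Qed.

Lemma generic_plus_neq_0 (a : nat -> C) (j k : nat) (r : R) :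
  generic a -> (j < 6)%nat -> (k < 6)%nat -> a j + a k + RtoC r <> 0.
Proof.
  intros [H _] Hj Hk. apply C_neq_snd. simpl. specialize (H j k Hj Hk). lra.
Qed.

Lemma Chalf_neq_0 (x : C) : x <> 0 -> x / 2 <> 0.
Proof.
  intros H H0. apply H. replace x with (x / 2 * 2) by field. rewrite H0. ring.
Qed.

Lemma Pfac_neq_0 (a : nat -> C) (n : nat -> Z) (h : Z) (i : nat) :
  generic a -> (i < 6)%nat -> Pfac a n h i <> 0.
Proof.
  intros Ha Hi. apply prodC_neq_0. intros j Hj. destruct (Nat.eqb j i); [apply C1_nz|].
  rewrite al_plus. apply Chalf_neq_0, generic_plus_neq_0; auto.
Qed.

(** Only the five pairs containing [i] change, and by [gam_succ] each gains the factor
    [al i + al j]. *)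
Lemma Rp_bump (a : nat -> C) (n : nat -> Z) (h : Z) (i : nat) : generic a -> (i < 6)%nat ->
  Rp (bumpC (fun k => Nat.eqb k i) a) (bumpZ (fun k => Nat.eqb k i) n) h =
  Pfac a n h i * Rp a n h.
Proof.
  intros Ha Hi. unfold Rp.
  set (f := fun j k => if Nat.eqb j i then al a n h j + al a n h k else
                       if Nat.eqb k i then al a n h j + al a n h k else 1).
  transitivity (prodC 6 (fun k => prodC k (fun j => f j k) *
    prodC k (fun j => gam (a j + a k) (n j + n k + h)))).
  - apply prodC_ext. intros k Hk. rewrite <- prodC_mult. apply prodC_ext. intros j Hj.
    unfold f, bumpC, bumpZ. rewrite al_plus.
    destruct (Nat.eqb_spec j i); destruct (Nat.eqb_spec k i); try lia.
    + replace (a j + 1 + a k) with (a j + a k + 1) by ring.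
      replace (n j + 1 + n k + h)%Z with (n j + n k + h + 1)%Z by lia.
      apply gam_succ. right. apply generic_plus_neq_0; auto; lia.
    + replace (a j + (a k + 1)) with (a j + a k + 1) by ring.
      replace (n j + (n k + 1) + h)%Z with (n j + n k + h + 1)%Z by lia.
      apply gam_succ. right. apply generic_plus_neq_0; auto; lia.
    + ring.
  - rewrite prodC_mult. f_equal. unfold Pfac, f.
    do 6 (destruct i as [|i]; [cbn [prodC Nat.eqb]; ring|]). lia.
Qed.

(** The factor 4 is [8 pi i] divided by the [2 pi i] of the residue theorem. The threshold is
    existential because the range of contributing [N] changes with every shift. *)
Definition evaluation (a : nat -> C) (n : nat -> Z) (h : Z) : Prop :=
  exists M0, forall M, (M0 <= M)%nat -> sumZ M (Jm a n h) = 4 * Rp a n h.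

Definition bound6 (n : nat -> Z) : nat :=
  Z.to_nat (Z.abs (n 0%nat) + Z.abs (n 1%nat) + Z.abs (n 2%nat) + Z.abs (n 3%nat)
    + Z.abs (n 4%nat) + Z.abs (n 5%nat) + 3).

Lemma idx_bounded_bound6 (n : nat -> Z) (M : nat) : (bound6 n <= M)%nat -> idx_bounded n M.
Proof.
  intros HM k Hk. unfold bound6 in HM.
  do 6 (destruct k as [|k]; [lia|]). lia.
Qed.

Lemma Cmult_cancel (p x y : C) : p <> 0 -> p * x = p * y -> x = y.
Proof.
  intros Hp H. replace x with (/ p * (p * x)) by (field; auto).
  rewrite H. field. auto.
Qed.

Lemma evaluation_step (a : nat -> C) (n : nat -> Z) (h : Z) (i : nat) :
  generic a -> (0 <= h <= 1)%Z -> (sum6 n + 3 * h = 1)%Z ->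
  sumC 6 a = - (1) -> (i < 5)%nat ->
  (evaluation (bumpC (fun k => Nat.eqb k i) a) (bumpZ (fun k => Nat.eqb k i) n) h <->
   evaluation (bumpC (fun k => Nat.eqb k 5) a) (bumpZ (fun k => Nat.eqb k 5) n) h).
Proof.
  intros Ha Hh Hn Hsa Hi.
  assert (H5 := Pfac_neq_0 a n h 5 Ha ltac:(lia)).
  assert (H6 := Pfac_neq_0 a n h i Ha ltac:(lia)).
  assert (S : forall M, (bound6 n <= M)%nat -> _) by
    exact (fun M HM => Jsum_step a n h M i Ha Hh ltac:(lia) Hsa Hi (idx_bounded_bound6 n M HM)).
  unfold evaluation. rewrite !Rp_bump by (auto; lia).
  split; intros [M0 H]; exists (Nat.max M0 (bound6 n)); intros M HM;
    specialize (S M ltac:(lia)); rewrite H in S by lia.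
  - apply (Cmult_cancel (Pfac a n h i)); auto. rewrite <- S. ring.
  - apply (Cmult_cancel (Pfac a n h 5)); auto. rewrite S. ring.
Qed.

(** * Reduction to base parameters *)

Definition lowerC (i : nat) (a : nat -> C) (k : nat) : C := if Nat.eqb k i then a k - 1 else a k.
Definition lowerZ (i : nat) (n : nat -> Z) (k : nat) : Z :=
  if Nat.eqb k i then (n k - 1)%Z else n k.

Lemma bumpC_lowerC (i : nat) (a : nat -> C) : bumpC (fun k => Nat.eqb k i) (lowerC i a) = a.
Proof.
  apply functional_extensionality. intros k. unfold bumpC, lowerC.
  destruct (Nat.eqb k i); auto. ring.
Qed.

Lemma bumpZ_lowerZ (i : nat) (n : nat -> Z) : bumpZ (fun k => Nat.eqb k i) (lowerZ i n) = n.
Proof.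
  apply functional_extensionality. intros k. unfold bumpZ, lowerZ.
  destruct (Nat.eqb k i); auto. lia.
Qed.

Lemma sum6_lowerZ (i : nat) (n : nat -> Z) : (i < 6)%nat -> sum6 (lowerZ i n) = (sum6 n - 1)%Z.
Proof.
  intros Hi. unfold sum6, lowerZ. do 6 (destruct i as [|i]; [cbn [Nat.eqb]; lia|]). lia.
Qed.

Lemma sum6_bumpZ (i : nat) (n : nat -> Z) : (i < 6)%nat ->
  sum6 (bumpZ (fun k => Nat.eqb k i) n) = (sum6 n + 1)%Z.
Proof.
  intros Hi. unfold sum6, bumpZ. do 6 (destruct i as [|i]; [cbn [Nat.eqb]; lia|]). lia.
Qed.

Lemma sumC_lowerC (i : nat) (a : nat -> C) : (i < 6)%nat ->
  sumC 6 (lowerC i a) = sumC 6 a - 1.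
Proof.
  intros Hi. unfold lowerC. do 6 (destruct i as [|i]; [cbn [sumC Nat.eqb]; ring|]). lia.
Qed.

Lemma sumC_bumpC (i : nat) (a : nat -> C) : (i < 6)%nat ->
  sumC 6 (bumpC (fun k => Nat.eqb k i) a) = sumC 6 a + 1.
Proof.
  intros Hi. unfold bumpC. do 6 (destruct i as [|i]; [cbn [sumC Nat.eqb]; ring|]). lia.
Qed.

Lemma generic_lowerC (i : nat) (a : nat -> C) : generic a -> generic (lowerC i a).
Proof.
  apply generic_same_snd. intros k. unfold lowerC. destruct (Nat.eqb k i); simpl; ring.
Qed.

Lemma generic_bumpC (e : nat -> bool) (a : nat -> C) : generic a -> generic (bumpC e a).
Proof.
  apply generic_same_snd. intros k. unfold bumpC. destruct (e k); simpl; ring.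
Qed.

Definition dist5 (n t : nat -> Z) : Z :=
  (Z.abs (n 0%nat - t 0%nat) + Z.abs (n 1%nat - t 1%nat) + Z.abs (n 2%nat - t 2%nat)
   + Z.abs (n 3%nat - t 3%nat) + Z.abs (n 4%nat - t 4%nat))%Z.

(** Index 5 serves as a reservoir: units are exchanged with it until the first five indices agree
    with [t], and the sum then fixes the last one. The [a_k] move by integers along the way, so the
    base case has to cover every generic [a]. *)
Lemma evaluation_reduce (h : Z) (t : nat -> Z) : (0 <= h <= 1)%Z -> (sum6 t + 3 * h = 2)%Z ->
  (forall a n, generic a -> sumC 6 a = 0 -> (forall k, (k < 6)%nat -> n k = t k) ->
     evaluation a n h) ->
  forall a n, generic a -> sumC 6 a = 0 -> (sum6 n + 3 * h = 2)%Z -> evaluation a n h.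
Proof.
  intros Hh Ht Hbase a n. remember (Z.to_nat (dist5 n t)) as D eqn:ED. revert a n ED.
  induction D as [D IH] using lt_wf_ind. intros a n ED Ha Hsa Hn.
  destruct (Z.eq_dec (dist5 n t) 0) as [E0|E0].
  - apply Hbase; auto. unfold dist5, sum6 in *. intros k Hk.
    do 6 (destruct k as [|k]; [lia|]). lia.
  - assert (Hex : exists i, (i < 5)%nat /\ n i <> t i).
    { destruct (Z.eq_dec (n 0%nat) (t 0%nat)); [|exists 0%nat; split; auto; lia].
      destruct (Z.eq_dec (n 1%nat) (t 1%nat)); [|exists 1%nat; split; auto; lia].
      destruct (Z.eq_dec (n 2%nat) (t 2%nat)); [|exists 2%nat; split; auto; lia].
      destruct (Z.eq_dec (n 3%nat) (t 3%nat)); [|exists 3%nat; split; auto; lia].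
      destruct (Z.eq_dec (n 4%nat) (t 4%nat)); [|exists 4%nat; split; auto; lia].
      exfalso. unfold dist5 in E0. lia. }
    destruct Hex as (i & Hi & Hni).
    destruct (Z_lt_le_dec (t i) (n i)) as [Hlt|Hle].
    + rewrite <- (bumpC_lowerC i a), <- (bumpZ_lowerZ i n).
      apply evaluation_step; auto using generic_lowerC.
      { rewrite sum6_lowerZ by lia. lia. }
      { rewrite sumC_lowerC, Hsa by lia. ring. }
      eapply IH; [|reflexivity|..]; auto using generic_lowerC, generic_bumpC.
      * rewrite ED. unfold dist5, bumpZ, lowerZ in *.
        do 5 (destruct i as [|i]; [cbn [Nat.eqb]; lia|]). lia.
      * rewrite sumC_bumpC, sumC_lowerC, Hsa by lia. ring.
      * rewrite sum6_bumpZ, sum6_lowerZ by lia. lia.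
    + rewrite <- (bumpC_lowerC 5 a), <- (bumpZ_lowerZ 5 n).
      apply (evaluation_step _ _ _ i); auto using generic_lowerC.
      { rewrite sum6_lowerZ by lia. lia. }
      { rewrite sumC_lowerC, Hsa by lia. ring. }
      eapply IH; [|reflexivity|..]; auto using generic_lowerC, generic_bumpC.
      * rewrite ED. unfold dist5, bumpZ, lowerZ in *.
        do 5 (destruct i as [|i]; [cbn [Nat.eqb]; lia|]). lia.
      * rewrite sumC_bumpC, sumC_lowerC, Hsa by lia. ring.
      * rewrite sum6_bumpZ, sum6_lowerZ by lia. lia.
Qed.

(** * The base parameters *)

Lemma gam_2 (x : C) : gam x 2 = x / 2.
Proof. unfold gam, poch. simpl. field. Qed.

Lemma gam_1 (x : C) : gam x 1 = 1.
Proof. reflexivity. Qed.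

Lemma gam_0 (x : C) : gam x 0 = / (x / 2).
Proof. unfold gam, poch. simpl. f_equal. field. Qed.

Lemma gam_m1 (x : C) : gam x (-1) = / ((x + 1) / 2 * ((x - 1) / 2)).
Proof.
  unfold gam, poch. simpl. f_equal.
  replace (1 + 1)%R with 2%R by ring. field.
Qed.

Lemma Upl_1 (x : C) : Upl x 1 = nil.
Proof. reflexivity. Qed.

Lemma Upl_0 (x : C) : Upl x 0 = (- x) :: nil.
Proof. unfold Upl. simpl. f_equal. ring. Qed.

Lemma Upl_m1 (x : C) : Upl x (-1) = (- x - 1) :: (- x + 1) :: nil.
Proof.
  unfold Upl. simpl. f_equal. ring.
Qed.

Lemma regpl_1 (x y : C) : regpl x 1 y = 1.
Proof. reflexivity. Qed.

Lemma regpl_0 (x y : C) : regpl x 0 y = 2.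
Proof. rewrite regpl_le_1 by lia. simpl. ring. Qed.

Lemma regpl_m1 (x y : C) : regpl x (-1) y = 4.
Proof. rewrite regpl_le_1 by lia. simpl. ring. Qed.

(** The residue at [-b] is [b] over twice the product of the other [c^2 - b^2], so the sum is, up to
    a factor, a divided difference of the square root at [b^2, c^2, d^2, e^2]. That is the alternant
    with exponents 0, 1, 2, 4 over the Vandermonde determinant of the squares, and the Schur
    polynomial of this alternant is [b + c + d + e]. *)
Lemma four_node_identity (b c d e : C) :
  b + b <> 0 -> c + c <> 0 -> d + d <> 0 -> e + e <> 0 ->
  b + c <> 0 -> b + d <> 0 -> b + e <> 0 -> c + d <> 0 -> c + e <> 0 -> d + e <> 0 ->
  b <> c -> b <> d -> b <> e -> c <> d -> c <> e -> d <> e ->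
  dd (- b :: - c :: - d :: - e :: nil)
    (fun y => y * y / ((b - y) * (c - y) * (d - y) * (e - y))) =
  - (b + c + d + e) / (2 * ((b + c) * (b + d) * (b + e) * (c + d) * (c + e) * (d + e))).
Proof.
  intros Hb Hc Hd He. intros. simpl dd.
  assert (b <> 0) by (intros ->; apply Hb; ring).
  assert (c <> 0) by (intros ->; apply Hc; ring).
  assert (d <> 0) by (intros ->; apply Hd; ring).
  assert (e <> 0) by (intros ->; apply He; ring).
  field.
  repeat split; auto;
    match goal with
    | |- ?x - - ?x <> _ => replace (x - - x) with (x + x) by ring; auto
    | |- - ?x - - ?y <> _ => replace (- x - - y) with (y - x) by ring; apply Csub_neq_0; auto
    end.
Qed.

Lemma evaluation_base_0 (a : nat -> C) (n : nat -> Z) :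
  generic a -> sumC 6 a = 0 ->
  (forall k, (k < 6)%nat -> n k = nth k (1 :: 1 :: 0 :: 0 :: 0 :: 0 :: nil)%Z 0%Z) ->
  evaluation a n 0.
Proof.
  intros Ha Hsa Hn.
  assert (N0 := Hn 0%nat ltac:(lia)). assert (N1 := Hn 1%nat ltac:(lia)).
  assert (N2 := Hn 2%nat ltac:(lia)). assert (N3 := Hn 3%nat ltac:(lia)).
  assert (N4 := Hn 4%nat ltac:(lia)). assert (N5 := Hn 5%nat ltac:(lia)).
  simpl in N0, N1, N2, N3, N4, N5.
  exists 0%nat. intros M HM. rewrite (sumZ_support 0 M); auto.
  2:{ intros m Hm. destruct (Z_lt_le_dec 0 m).
      - apply Lam_high. intros k Hk. unfold plidx. rewrite Hn by auto.
        do 6 (destruct k as [|k]; [cbn [nth]; lia|]). lia.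
      - apply (Lam_low a n 0 m 2); auto.
        + apply (dd_degree_ext 2 2 (fun y => 1 * (1 * (y - Nc 0 m)) * (1 * (y - - Nc 0 m))));
            auto; [|intros; ring].
          apply dd_degree_mul, dd_degree_mul, (dd_degree_cst 1).
        + intros k Hk. unfold plidx. rewrite Hn by auto.
          do 6 (destruct k as [|k]; [cbn [nth]; lia|]). lia.
        + unfold sum6. lia. }
  unfold sumZ, Jm, Lam, Rp, nodes, plidx. simpl Nat.mul. simpl Nat.add. cbn [sumC seq flat_map prodC].
  rewrite N0, N1, N2, N3, N4, N5. simpl Z.of_nat. simpl Z.sub. simpl Z.add.
  rewrite !gam_1, !gam_2, !gam_0, !Upl_1, !Upl_0. cbn [app].
  destruct Ha as [Hp Hd].
  (* Each of the four indices with [N_k = 0] gives a 2 from [regpl] and a 2 from [gam], and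
     [256 = 2^8]. *)
  rewrite (dd_ext _ _ (fun y => 256 * (y * y /
    ((a 2%nat - y) * (a 3%nat - y) * (a 4%nat - y) * (a 5%nat - y))))).
  - rewrite dd_scal. rewrite (four_node_identity (a 2%nat) (a 3%nat) (a 4%nat) (a 5%nat)) by (apply C_neq_snd; simpl; auto with arith).
    assert (E : a 0%nat + a 1%nat = - (a 2%nat + a 3%nat + a 4%nat + a 5%nat)).
    { simpl in Hsa. transitivity (0 + a 0%nat + a 1%nat + a 2%nat + a 3%nat + a 4%nat + a 5%nat
        - (a 2%nat + a 3%nat + a 4%nat + a 5%nat)); [ring|]. rewrite Hsa. ring. }
    rewrite E. field. repeat split; apply C_neq_snd; simpl; auto with arith.
  - intros y Hy. rewrite !gam_1, !gam_0, !regpl_1, !regpl_0. unfold Nc.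
    assert (G : forall k, (k < 6)%nat -> a k - y <> 0).
    { intros k Hk. apply C_neq_snd. simpl in Hy |- *.
      destruct Hy as [<-|[<-|[<-|[<-|[]]]]]; simpl; rewrite Ropp_involutive; auto with arith. }
    field. repeat split; apply G; lia.
Qed.

Lemma evaluation_base_1 (a : nat -> C) (n : nat -> Z) :
  generic a -> sumC 6 a = 0 ->
  (forall k, (k < 6)%nat -> n k = nth k (0 :: 0 :: 0 :: 0 :: 0 :: -1 :: nil)%Z 0%Z) ->
  evaluation a n 1.
Proof.
  intros Ha Hsa Hn.
  assert (N0 := Hn 0%nat ltac:(lia)). assert (N1 := Hn 1%nat ltac:(lia)).
  assert (N2 := Hn 2%nat ltac:(lia)). assert (N3 := Hn 3%nat ltac:(lia)).
  assert (N4 := Hn 4%nat ltac:(lia)). assert (N5 := Hn 5%nat ltac:(lia)).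
  simpl in N0, N1, N2, N3, N4, N5.
  assert (H0 : forall m, (m <> 0)%Z -> (m <> -1)%Z -> Jm a n 1 m = 0).
  { intros m Hm Hm1. destruct (Z_lt_le_dec 0 m).
    - apply Lam_high. intros k Hk. unfold plidx. rewrite Hn by auto.
      do 6 (destruct k as [|k]; [cbn [nth]; lia|]). lia.
    - apply (Lam_low a n 1 m 2); auto.
      + apply (dd_degree_ext 2 2 (fun y => 1 * (1 * (y - Nc 1 m)) * (1 * (y - - Nc 1 m))));
          auto; [|intros; ring].
        apply dd_degree_mul, dd_degree_mul, (dd_degree_cst 1).
      + intros k Hk. unfold plidx. rewrite Hn by auto.
        do 6 (destruct k as [|k]; [cbn [nth]; lia|]). lia.
      + unfold sum6. lia. }
  assert (Ep : forall k r, (k < 6)%nat -> a k + a 5%nat + RtoC r <> 0)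
    by (intros; apply generic_plus_neq_0; auto; lia).
  assert (Ep0 : forall k, (k < 6)%nat -> a k + a 5%nat <> 0).
  { intros k Hk. rewrite <- (Cplus_0_r (_ + _)). apply (Ep k 0%R Hk). }
  assert (Em : a 5%nat + a 5%nat - 1 <> 0).
  { replace (a 5%nat + a 5%nat - 1) with (a 5%nat + a 5%nat + RtoC (-1)) by ring.
    apply Ep; lia. }
  set (T := 64 / ((a 0%nat + a 5%nat) * (a 1%nat + a 5%nat) * (a 2%nat + a 5%nat)
    * (a 3%nat + a 5%nat) * (a 4%nat + a 5%nat))).
  (* At the only node [- a_5] the weight [y^2 - 1/4] cancels [gam (2 a_5) (-1) = 1/(a_5^2 - 1/4)].
     The constant 64 is 2 from [regpl] times [2^5] from the other minus-sign factors. *)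
  assert (J0 : Jm a n 1 0 = T).
  { unfold Jm, Lam, nodes, plidx. cbn [seq flat_map prodC].
    rewrite N0, N1, N2, N3, N4, N5. simpl Z.sub. simpl Z.add.
    rewrite !Upl_1, Upl_0. cbn [app dd lprod fold_right].
    rewrite !gam_0, gam_m1, !regpl_1, regpl_0. unfold Nc, T.
    field. replace (a 5%nat - - a 5%nat) with (a 5%nat + a 5%nat) by ring.
    replace (a 4%nat - - a 5%nat) with (a 4%nat + a 5%nat) by ring.
    replace (a 3%nat - - a 5%nat) with (a 3%nat + a 5%nat) by ring.
    replace (a 2%nat - - a 5%nat) with (a 2%nat + a 5%nat) by ring.
    replace (a 1%nat - - a 5%nat) with (a 1%nat + a 5%nat) by ring.
    replace (a 0%nat - - a 5%nat) with (a 0%nat + a 5%nat) by ring.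
    repeat split; auto with arith. }
  assert (J1 : Jm a n 1 (-1) = T).
  { (* The residues at the nodes add up to minus the residue at the unique lower pole [a 5]. *)
    assert (HN := generic_nodes_NoDup a (plidx n 1 (-1)) Ha).
    assert (Hq : ~ In (a 5%nat) (nodes a (plidx n 1 (-1)) (seq 0 6))).
    { intros H. apply (generic_minus_neq_0 a _ 5 _ 0%R Ha ltac:(lia) H). ring. }
    unfold Jm, Lam. set (P := fun y => y * y - Nc 1 (-1) * Nc 1 (-1)).
    assert (HP : dd_degree_le 2 P).
    { apply (dd_degree_ext 2 2 (fun y => 1 * (1 * (y - Nc 1 (-1))) * (1 * (y - - Nc 1 (-1)))));
        auto; [|intros; unfold P; ring].
      apply dd_degree_mul, dd_degree_mul, (dd_degree_cst 1). }
    specialize (HP _ (NoDup_cons _ Hq HN)).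
    set (U := nodes a (plidx n 1 (-1)) (seq 0 6)) in *.
    assert (EU : U = (- a 0%nat) :: (- a 1%nat) :: (- a 2%nat) :: (- a 3%nat) :: (- a 4%nat)
      :: (- a 5%nat - 1) :: (- a 5%nat + 1) :: nil).
    { unfold U, nodes, plidx. cbn [seq flat_map].
      rewrite N0, N1, N2, N3, N4, N5. simpl Z.add.
      rewrite !Upl_0, Upl_m1. reflexivity. }
    specialize (HP ltac:(rewrite EU; simpl; lia)). cbn [dd] in HP.
    (* The constant is [2^5 * 4] from [regpl] times the [-2] of [gam (a_5 - y) 0 = -2/(y - a_5)]. *)
    rewrite (dd_ext _ _ (fun y => - 256 * (P y / (y - a 5%nat)))).
    - rewrite dd_scal.
      transitivity (256 * (P (a 5%nat) / lprod U (a 5%nat))).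
      + match type of HP with ?x + ?y = _ =>
          transitivity (256 * x - 256 * (x + y)); [ring | rewrite HP; ring] end.
      + rewrite EU. cbn [lprod fold_right]. unfold P, Nc, T. field.
        replace (a 5%nat - - a 4%nat) with (a 4%nat + a 5%nat) by ring.
        replace (a 5%nat - - a 3%nat) with (a 3%nat + a 5%nat) by ring.
        replace (a 5%nat - - a 2%nat) with (a 2%nat + a 5%nat) by ring.
        replace (a 5%nat - - a 1%nat) with (a 1%nat + a 5%nat) by ring.
        replace (a 5%nat - - a 0%nat) with (a 0%nat + a 5%nat) by ring.
        assert (a 5%nat - (- a 5%nat - 1) <> 0)
          by (replace (a 5%nat - (- a 5%nat - 1)) with (a 5%nat + a 5%nat + RtoC 1) by ring;
              auto with arith).
        assert (a 5%nat - (- a 5%nat + 1) <> 0)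
          by (replace (a 5%nat - (- a 5%nat + 1)) with (a 5%nat + a 5%nat - 1) by ring; auto).
        repeat split; auto with arith.
    - intros y Hy. unfold plidx. cbn [prodC].
      rewrite N0, N1, N2, N3, N4, N5. simpl Z.sub. simpl Z.add.
      rewrite !gam_1, gam_0, !regpl_0, regpl_m1.
      assert (y <> a 5%nat) by (intros ->; auto).
      unfold P. field. split; apply Csub_neq_0; auto. }
  exists 1%nat. intros M HM. rewrite (sumZ_support 1 M); auto.
  2:{ intros m Hm. apply H0; lia. }
  unfold sumZ. simpl Nat.mul. simpl Nat.add. cbn [sumC].
  simpl Z.of_nat. simpl Z.sub. rewrite J0, J1, (H0 1%Z) by lia.
  unfold Rp. cbn [prodC]. rewrite N0, N1, N2, N3, N4, N5. simpl Z.add.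
  rewrite !gam_1, !gam_0. unfold T. field. repeat split; auto with arith.
Qed.

Lemma evaluation_generic (a : nat -> C) (n : nat -> Z) (h : Z) : (h = 0 \/ h = 1)%Z ->
  generic a -> sumC 6 a = 0 -> (sum6 n + 3 * h = 2)%Z -> evaluation a n h.
Proof.
  intros [-> | ->].
  - apply (evaluation_reduce 0 (fun k => nth k (1 :: 1 :: 0 :: 0 :: 0 :: 0 :: nil)%Z 0%Z));
      [lia|reflexivity|]. intros; now apply evaluation_base_0.
  - apply (evaluation_reduce 1 (fun k => nth k (0 :: 0 :: 0 :: 0 :: 0 :: -1 :: nil)%Z 0%Z));
      [lia|reflexivity|]. intros; now apply evaluation_base_1.
Qed.

(** * Limits, derivatives and integrals of complex-valued functions *)

Notation CR := (prod_NormedModule R_AbsRing R_NormedModule R_NormedModule).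

Section Limits.
Context {T : Type} {F : (T -> Prop) -> Prop} {FF : Filter F}.

Lemma filterlim_C_pair (f : T -> C) (l : C) :
  filterlim (fun t => fst (f t)) F (locally (fst l)) ->
  filterlim (fun t => snd (f t)) F (locally (snd l)) ->
  filterlim f F (locally l).
Proof.
  intros H1 H2. apply filterlim_locally. intros eps.
  apply filterlim_locally with (eps := eps) in H1.
  apply filterlim_locally with (eps := eps) in H2.
  generalize (filter_and _ _ H1 H2). apply filter_imp. intros t [Ha Hb]. now split.
Qed.

Lemma filterlim_C_fst (f : T -> C) (l : C) :
  filterlim f F (locally l) -> filterlim (fun t => fst (f t)) F (locally (fst l)).
Proof.
  intros H. apply filterlim_locally. intros eps.
  apply filterlim_locally with (eps := eps) in H.
  revert H. apply filter_imp. intros t [Ha _]. exact Ha.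
Qed.

Lemma filterlim_C_snd (f : T -> C) (l : C) :
  filterlim f F (locally l) -> filterlim (fun t => snd (f t)) F (locally (snd l)).
Proof.
  intros H. apply filterlim_locally. intros eps.
  apply filterlim_locally with (eps := eps) in H.
  revert H. apply filter_imp. intros t [_ Hb]. exact Hb.
Qed.

Lemma filterlim_R_plus (f g : T -> R) (x y : R) :
  filterlim f F (locally x) -> filterlim g F (locally y) ->
  filterlim (fun t => (f t + g t)%R) F (locally (x + y)%R).
Proof.
  intros Hf Hg. eapply filterlim_comp_2; [exact Hf|exact Hg|].
  apply (filterlim_plus (K := R_AbsRing) (V := R_NormedModule) x y).
Qed.

Lemma filterlim_R_mult (f g : T -> R) (x y : R) :
  filterlim f F (locally x) -> filterlim g F (locally y) ->
  filterlim (fun t => (f t * g t)%R) F (locally (x * y)%R).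
Proof.
  intros Hf Hg. eapply filterlim_comp_2; [exact Hf|exact Hg|].
  apply (filterlim_mult (K := R_AbsRing) x y).
Qed.

Lemma filterlim_R_opp (f : T -> R) (x : R) :
  filterlim f F (locally x) -> filterlim (fun t => (- f t)%R) F (locally (- x)%R).
Proof.
  intros Hf. eapply filterlim_comp; [exact Hf|].
  apply (filterlim_opp (K := R_AbsRing) (V := R_NormedModule) x).
Qed.

Lemma filterlim_R_inv (f : T -> R) (x : R) : x <> 0%R ->
  filterlim f F (locally x) -> filterlim (fun t => (/ f t)%R) F (locally (/ x)%R).
Proof.
  intros Hx Hf. eapply filterlim_comp; [exact Hf|].
  apply (continuous_Rinv x Hx).
Qed.

Lemma filterlim_C_plus (f g : T -> C) (x y : C) :
  filterlim f F (locally x) -> filterlim g F (locally y) ->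
  filterlim (fun t => f t + g t) F (locally (x + y)).
Proof.
  intros Hf Hg. apply filterlim_C_pair; simpl; apply filterlim_R_plus;
    auto using filterlim_C_fst, filterlim_C_snd.
Qed.

Lemma filterlim_C_opp (f : T -> C) (x : C) :
  filterlim f F (locally x) -> filterlim (fun t => - f t) F (locally (- x)).
Proof.
  intros Hf. apply filterlim_C_pair; simpl; apply filterlim_R_opp;
    auto using filterlim_C_fst, filterlim_C_snd.
Qed.

Lemma filterlim_C_minus (f g : T -> C) (x y : C) :
  filterlim f F (locally x) -> filterlim g F (locally y) ->
  filterlim (fun t => f t - g t) F (locally (x - y)).
Proof. intros Hf Hg. apply filterlim_C_plus, filterlim_C_opp; auto. Qed.

Lemma filterlim_C_mult (f g : T -> C) (x y : C) :
  filterlim f F (locally x) -> filterlim g F (locally y) ->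
  filterlim (fun t => f t * g t) F (locally (x * y)).
Proof.
  intros Hf Hg.
  apply filterlim_C_pair; simpl; [|apply filterlim_R_plus];
    [apply filterlim_R_plus; [|apply filterlim_R_opp]|..];
    apply filterlim_R_mult; auto using filterlim_C_fst, filterlim_C_snd.
Qed.

Lemma C_sqr_norm_neq_0 (x : C) : x <> 0 -> (fst x ^ 2 + snd x ^ 2)%R <> 0%R.
Proof.
  intros Hx H. apply Hx. destruct x as [u v]; simpl in *.
  assert (u = 0%R) by nra. assert (v = 0%R) by nra. subst. reflexivity.
Qed.

Lemma filterlim_C_inv (f : T -> C) (x : C) : x <> 0 ->
  filterlim f F (locally x) -> filterlim (fun t => / f t) F (locally (/ x)).
Proof.
  intros Hx Hf. pose proof (C_sqr_norm_neq_0 x Hx) as Hn.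
  assert (Hd : filterlim (fun t => (/ (fst (f t) ^ 2 + snd (f t) ^ 2))%R) F
                 (locally (/ (fst x ^ 2 + snd x ^ 2))%R)).
  { apply filterlim_R_inv; auto. simpl.
    apply filterlim_R_plus; apply filterlim_R_mult; auto using filterlim_C_fst, filterlim_C_snd;
    apply filterlim_R_mult; auto using filterlim_C_fst, filterlim_C_snd; apply filterlim_const. }
  apply filterlim_C_pair; apply filterlim_R_mult; auto; [|apply filterlim_R_opp];
    auto using filterlim_C_fst, filterlim_C_snd.
Qed.

Lemma filterlim_C_pow (f : T -> C) (x : C) (k : nat) :
  filterlim f F (locally x) -> filterlim (fun t => f t ^ k) F (locally (x ^ k)).
Proof.
  intros Hf. induction k as [|k IH]; simpl.
  - apply filterlim_const.
  - apply filterlim_C_mult; auto.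
Qed.

End Limits.

Lemma is_RInt_C_scal (c : C) (f : R -> C) (a b : R) (l : C) :
  is_RInt (V := CR) f a b l -> is_RInt (V := CR) (fun t => c * f t) a b (c * l).
Proof.
  intros H.
  pose proof (is_RInt_fct_extend_fst (U := R_NormedModule) (V := R_NormedModule) f a b l H) as H1.
  pose proof (is_RInt_fct_extend_snd (U := R_NormedModule) (V := R_NormedModule) f a b l H) as H2.
  apply (is_RInt_fct_extend_pair (U := R_NormedModule) (V := R_NormedModule)); simpl.
  - apply (is_RInt_minus (V := R_NormedModule));
      apply (is_RInt_scal (V := R_NormedModule)); assumption.
  - apply (is_RInt_plus (V := R_NormedModule));
      apply (is_RInt_scal (V := R_NormedModule)); assumption.
Qed.

Lemma is_RInt_gen_C_scal (Fa Fb : (R -> Prop) -> Prop) (HFa : Filter Fa) (HFb : Filter Fb)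
    (c : C) (f : R -> C) (l : C) :
  is_RInt_gen (V := CR) f Fa Fb l -> is_RInt_gen (V := CR) (fun t => c * f t) Fa Fb (c * l).
Proof.
  intros H P HP.
  assert (HP' : locally (T := CR) l (fun y => P (c * y))).
  { apply (filterlim_C_mult (F := locally l) (fun _ => c) (fun y => y) c l);
      [apply filterlim_const|apply filterlim_id|exact HP]. }
  specialize (H _ HP'). unfold filtermapi in *. revert H. apply filter_imp.
  intros ab (y & Hy & Py). exists (c * y). split; auto. now apply is_RInt_C_scal.
Qed.

Lemma is_derive_C_pair (f : R -> C) (t : R) (l : C) :
  is_derive (V := R_NormedModule) (fun s => fst (f s)) t (fst l) ->
  is_derive (V := R_NormedModule) (fun s => snd (f s)) t (snd l) ->
  is_derive (V := CR) f t l.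
Proof.
  intros H1 H2.
  apply (is_derive_ext (V := CR) (fun s => plus (scal (fst (f s)) ((1%R, 0%R) : CR))
     (scal (snd (f s)) ((0%R, 1%R) : CR)))).
  { intros s. destruct (f s) as [u v]. unfold plus, scal; simpl.
    unfold prod_plus, prod_scal, plus, scal; simpl. unfold mult; simpl. f_equal; ring. }
  replace l with (plus (scal (fst l) ((1%R, 0%R) : CR)) (scal (snd l) ((0%R, 1%R) : CR))).
  2:{ destruct l as [u v]. unfold plus, scal; simpl.
    unfold prod_plus, prod_scal, plus, scal; simpl. unfold mult; simpl. f_equal; ring. }
  apply (is_derive_plus (V := CR)); apply (is_derive_scal_l (V := CR)); assumption.
Qed.

Lemma is_derive_C_fst (f : R -> C) (t : R) (l : C) :
  is_derive (V := CR) f t l -> is_derive (V := R_NormedModule) (fun s => fst (f s)) t (fst l).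
Proof.
  intros H. unfold is_derive in *.
  apply (filterdiff_comp' f (fun z : CR => fst z : R_NormedModule) t
    (fun y => scal y l) (fun z : CR => fst z : R_NormedModule)); auto.
  apply filterdiff_linear. apply is_linear_fst.
Qed.

Lemma is_derive_C_snd (f : R -> C) (t : R) (l : C) :
  is_derive (V := CR) f t l -> is_derive (V := R_NormedModule) (fun s => snd (f s)) t (snd l).
Proof.
  intros H. unfold is_derive in *.
  apply (filterdiff_comp' f (fun z : CR => snd z : R_NormedModule) t
    (fun y => scal y l) (fun z : CR => snd z : R_NormedModule)); auto.
  apply filterdiff_linear. apply is_linear_snd.
Qed.

Lemma is_derive_C_mult (f g : R -> C) (t : R) (l l' : C) :
  is_derive (V := CR) f t l -> is_derive (V := CR) g t l' ->
  is_derive (V := CR) (fun s => f s * g s) t (l * g t + f t * l').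
Proof.
  intros Hf Hg.
  pose proof (is_derive_C_fst f t l Hf) as Hf1. pose proof (is_derive_C_snd f t l Hf) as Hf2.
  pose proof (is_derive_C_fst g t l' Hg) as Hg1. pose proof (is_derive_C_snd g t l' Hg) as Hg2.
  assert (Hm : forall (u v : R -> R) (du dv : R), is_derive u t du -> is_derive v t dv ->
    is_derive (fun s => (u s * v s)%R) t (du * v t + u t * dv)%R).
  { intros u v du dv Hu Hv. apply (is_derive_mult (K := R_AbsRing) u v t du dv Hu Hv Rmult_comm). }
  apply is_derive_C_pair; simpl.
  - evar_last.
    + apply (is_derive_minus (V := R_NormedModule)); apply Hm; eassumption.
    + unfold minus, plus, opp; simpl. ring.
  - evar_last.
    + apply (is_derive_plus (V := R_NormedModule)); apply Hm; eassumption.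
    + unfold plus; simpl. ring.
Qed.

Lemma is_derive_C_inv (f : R -> C) (t : R) (l : C) : f t <> 0 ->
  is_derive (V := CR) f t l ->
  is_derive (V := CR) (fun s => / f s) t (- l * / f t * / f t).
Proof.
  intros H0 Hf. pose proof (C_sqr_norm_neq_0 _ H0) as Hn.
  pose proof (is_derive_C_fst f t l Hf) as Hf1. pose proof (is_derive_C_snd f t l Hf) as Hf2.
  assert (Hm : forall (u v : R -> R) (du dv : R), is_derive u t du -> is_derive v t dv ->
    is_derive (fun s => (u s * v s)%R) t (du * v t + u t * dv)%R).
  { intros u v du dv Hu Hv. apply (is_derive_mult (K := R_AbsRing) u v t du dv Hu Hv Rmult_comm). }
  assert (Hd : is_derive (fun s => (fst (f s) ^ 2 + snd (f s) ^ 2)%R) t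
     (2 * fst (f t) * fst l + 2 * snd (f t) * snd l)%R).
  { apply (is_derive_ext (V := R_NormedModule)
      (fun s => (fst (f s) * fst (f s) + snd (f s) * snd (f s))%R)); [intros s; simpl; ring|].
    evar_last.
    - apply (is_derive_plus (V := R_NormedModule)); apply Hm; eassumption.
    - unfold plus; simpl. ring. }
  pose proof (is_derive_inv _ t _ Hd Hn) as Hi.
  apply is_derive_C_pair; simpl.
  - evar_last; [apply Hm; [exact Hf1|exact Hi]|].
    simpl in *. field. simpl in Hn. rewrite ?Rmult_1_r in *. auto.
  - evar_last; [apply Hm; [apply (is_derive_opp (V := R_NormedModule)); exact Hf2|exact Hi]|].
    unfold opp; simpl in *. field. simpl in Hn. rewrite ?Rmult_1_r in *. auto.
Qed.

Lemma is_derive_C_pow (f : R -> C) (t : R) (l : C) (k : nat) :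
  is_derive (V := CR) f t l ->
  is_derive (V := CR) (fun s => f s ^ S k) t (RtoC (INR (S k)) * l * f t ^ k).
Proof.
  intros Hf. induction k as [|k IH].
  - apply (is_derive_ext (V := CR) f); [intros s; symmetry; apply Cpow_1_r|].
    replace (RtoC (INR 1) * l * f t ^ 0) with l by (simpl; ring). exact Hf.
  - apply (is_derive_ext (V := CR) (fun s => f s * f s ^ S k)); [reflexivity|].
    replace (RtoC (INR (S (S k))) * l * f t ^ S k)
      with (l * f t ^ S k + f t * (RtoC (INR (S k)) * l * f t ^ k)).
    + now apply is_derive_C_mult.
    + rewrite (S_INR (S k)), RtoC_plus. simpl Cpow. ring.
Qed.

Lemma continuous_of_is_derive_C (f : R -> C) (t : R) (l : C) :
  is_derive (V := CR) f t l -> filterlim f (locally t) (locally (f t)).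
Proof.
  intros H. apply filterlim_C_pair.
  - apply (ex_derive_continuous (V := R_NormedModule) (fun s => fst (f s))).
    eexists. apply is_derive_C_fst, H.
  - apply (ex_derive_continuous (V := R_NormedModule) (fun s => snd (f s))).
    eexists. apply is_derive_C_snd, H.
Qed.

(* Replaces the principal value of [int_{-T}^T] by an integral with independent endpoints. *)
Lemma is_RInt_gen_of_symmetric (f w : R -> R) (K R0 l : R) :
  (forall t, continuous f t) -> (0 < R0)%R ->
  (forall t, (t <= - R0)%R -> (Rabs (f t) <= K / t ^ 2)%R) ->
  (forall T, is_RInt f (- T) T (w T)) ->
  filterlim w (Rbar_locally p_infty) (locally l) ->
  is_RInt_gen f (Rbar_locally m_infty) (Rbar_locally p_infty) l.
Proof.
  intros Hf HR Hb Hw Hl.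
  assert (Hex : forall a b, ex_RInt f a b).
  { intros a b. apply (ex_RInt_continuous (V := R_CompleteNormedModule)). auto. }
  assert (HK : (0 <= K)%R).
  { specialize (Hb (- R0)%R ltac:(lra)). pose proof (Rabs_pos (f (- R0)%R)) as Hp.
    apply Rnot_lt_le. intros HK.
    assert (K / (- R0) ^ 2 < 0)%R; [|lra].
    apply Rdiv_neg_pos; nra. }
  assert (Hprim : forall a c, (a <= c)%R -> (c < 0)%R ->
    is_RInt (fun t => (K / t ^ 2)%R) a c (- K / c - - K / a)%R).
  { intros a c Hac Hc. apply (is_RInt_derive (V := R_CompleteNormedModule) (fun t => (- K / t)%R)).
    - intros t Ht. rewrite Rmax_right in Ht by lra. auto_derive; [lra|]. field. lra.
    - intros t Ht. rewrite Rmax_right in Ht by lra.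
      apply (ex_derive_continuous (V := R_NormedModule)). auto_derive. nra. }
  assert (Htail : forall a c, (a <= c)%R -> (c <= - R0)%R -> (Rabs (RInt f a c) <= K / - c)%R).
  { intros a c Hac Hc.
    apply Rle_trans with (- K / c - - K / a)%R.
    - apply (norm_RInt_le (V := R_NormedModule) f (fun t => (K / t ^ 2)%R) a c); auto.
      + intros t Ht. apply Hb. lra.
      + apply (RInt_correct (V := R_CompleteNormedModule)). auto.
      + apply Hprim; lra.
    - assert (0 <= K / - a)%R by (apply Rdiv_le_0_compat; lra).
      replace (- K / c - - K / a)%R with (K / - c - K / - a)%R by (field; lra). lra. }
  (* The integral from [a] to [b] is split at [- b]: the part from [- b] to [b] is [w b], and the
     rest lies in the left tail, where [K/t^2] makes it small whichever of [a] and [- b] is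
     larger. *)
  assert (HL : filterlim (fun ab : R * R => RInt f (fst ab) (snd ab))
     (filter_prod (Rbar_locally m_infty) (Rbar_locally p_infty)) (locally l)).
  { apply filterlim_locally. intros eps.
    assert (He : (0 < eps / 2)%R) by (destruct eps; simpl; lra).
    apply filterlim_locally with (eps := mkposreal _ He) in Hl.
    destruct Hl as [B HB].
    set (D := Rmax R0 (2 * K / eps + 1)).
    assert (HD1 : (R0 <= D)%R) by apply Rmax_l.
    assert (HD2 : (2 * K / eps + 1 <= D)%R) by apply Rmax_r.
    assert (HKD : forall x, (D <= x)%R -> (K / x < eps / 2)%R).
    { intros x Hx. apply (Rmult_lt_reg_r x); [lra|].
      replace (K / x * x)%R with K by (field; lra).
      assert (eps / 2 * (2 * K / eps) = K)%R by (field; destruct eps; simpl; lra).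
      nra. }
    exists (fun a => (a < - D)%R) (fun b => (Rmax D B < b)%R).
    - exists (- D)%R. auto.
    - exists (Rmax D B). auto.
    - intros a b Ha Hb'. simpl.
      assert (D < b)%R by (pose proof (Rmax_l D B); lra).
      assert (B < b)%R by (pose proof (Rmax_r D B); lra).
      specialize (HB b ltac:(auto)).
      assert (Ew : RInt f (- b)%R b = w b) by (apply (is_RInt_unique (V := R_CompleteNormedModule)), Hw).
      assert (Ec : RInt f a b = (RInt f a (- b)%R + w b)%R).
      { rewrite <- Ew. symmetry.
        apply (RInt_Chasles (V := R_CompleteNormedModule) f a (- b)%R b); auto. }
      assert (Ht : (Rabs (RInt f a (- b)%R) < eps / 2)%R).
      { destruct (Rle_dec a (- b)) as [Hab|Hab].
        - eapply Rle_lt_trans; [apply Htail; lra|]. rewrite Ropp_involutive. apply HKD. lra.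
        - rewrite <- (opp_RInt_swap (V := R_CompleteNormedModule)) by auto.
          unfold opp; simpl. rewrite Rabs_Ropp.
          eapply Rle_lt_trans; [apply Htail; lra|]. apply HKD. lra. }
      change (Rabs (RInt f a b - l) < eps)%R. rewrite Ec.
      change (Rabs (w b - l) < eps / 2)%R in HB.
      replace (RInt f a (- b)%R + w b - l)%R with (RInt f a (- b)%R + (w b - l))%R by ring.
      eapply Rle_lt_trans; [apply Rabs_triang|]. lra. }
  intros P HP. specialize (HL P HP). unfold filtermapi, filtermap in *.
  revert HL. apply filter_imp. intros [a b] HPab.
  exists (RInt f a b). split; auto. apply (RInt_correct (V := R_CompleteNormedModule)). apply Hex.
Qed.

Lemma is_RInt_gen_C_pair (Fa Fb : (R -> Prop) -> Prop) (HFa : Filter Fa) (HFb : Filter Fb)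
    (f : R -> C) (l : C) :
  is_RInt_gen (V := R_NormedModule) (fun t => fst (f t)) Fa Fb (fst l) ->
  is_RInt_gen (V := R_NormedModule) (fun t => snd (f t)) Fa Fb (snd l) ->
  is_RInt_gen (V := CR) f Fa Fb l.
Proof.
  intros H1 H2 P [eps HP].
  assert (P1 : locally (fst l) (ball (fst l) eps)) by (exists eps; auto).
  assert (P2 : locally (snd l) (ball (snd l) eps)) by (exists eps; auto).
  specialize (H1 _ P1). specialize (H2 _ P2). unfold filtermapi in *.
  generalize (filter_and _ _ H1 H2). apply filter_imp.
  intros ab [(y1 & Hy1 & B1) (y2 & Hy2 & B2)].
  exists (y1, y2). split.
  - apply (is_RInt_fct_extend_pair (U := R_NormedModule) (V := R_NormedModule)); auto.
  - apply HP. now split.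
Qed.

(** * Contour integrals of rational functions by partial fractions *)

Ltac as_C := match goal with |- @eq _ ?x ?y => change (@eq C x y) end.

Lemma contour_far (g dg : R -> C) : is_contour g dg ->
  exists T1, (0 < T1)%R /\ forall t, (T1 <= Rabs t)%R -> g t = RtoC t /\ dg t = 1.
Proof.
  (* The margin 1 makes [g s = s] hold on a whole neighbourhood of [t], which determines the
     derivative there. *)
  intros (Hg & _ & T0 & H0). exists (Rmax T0 0 + 1)%R.
  pose proof (Rmax_l T0 0). pose proof (Rmax_r T0 0).
  split; [lra|]. intros t Ht. split; [apply H0; lra|].
  assert (Hloc : locally t (fun s : R => g s = RtoC s)).
  { exists (mkposreal 1 Rlt_0_1). intros s Hs. apply H0.
    change (Rabs (s - t) < 1)%R in Hs.
    pose proof (Rabs_triang (t - s) s) as Htr.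
    replace (t - s + s)%R with t in Htr by ring. rewrite Rabs_minus_sym in Htr. lra. }
  specialize (Hg t). destruct (dg t) as [u v] eqn:E.
  assert (D1 : is_derive (fun s : R => s) t u).
  { apply (is_derive_ext_loc (V := R_NormedModule) (fun s => fst (g s))).
    - revert Hloc. apply filter_imp. intros s ->. reflexivity.
    - apply (is_derive_C_fst g t (u, v) Hg). }
  assert (D2 : is_derive (fun s : R => 0%R) t v).
  { apply (is_derive_ext_loc (V := R_NormedModule) (fun s => snd (g s))).
    - revert Hloc. apply filter_imp. intros s ->. reflexivity.
    - apply (is_derive_C_snd g t (u, v) Hg). }
  apply is_derive_unique in D1, D2. rewrite Derive_id in D1. rewrite Derive_const in D2.
  unfold RtoC. now subst.
Qed.

Lemma far_lower_bound (p : C) (t : R) : (2 * Cmod p < Rabs t)%R ->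
  (Rabs t / 2 <= Cmod (RtoC t - p))%R.
Proof.
  intros H. pose proof (Cmod_triangle (RtoC t - p) p) as Htr.
  replace (RtoC t - p + p) with (RtoC t) in Htr by ring. rewrite Cmod_R in Htr. lra.
Qed.

Lemma Cmod_fst (z : C) : (Rabs (fst z) <= Cmod z)%R.
Proof. eapply Rle_trans; [apply Rmax_l|apply Rmax_Cmod]. Qed.

Lemma Cmod_snd (z : C) : (Rabs (snd z) <= Cmod z)%R.
Proof. eapply Rle_trans; [apply Rmax_r|apply Rmax_Cmod]. Qed.

(** The integrals of [1/(y-p)] and [1/(y-q)] exist only as principal values, but their difference
    decays like [t^-2], so its symmetric limit is a true improper integral. The value is 0 for
    points on one side and [2 pi i/(p-q)] for [p] on the left and [q] on the right. *)
Lemma contour_integral_pair (g dg : R -> C) (p q vp vq : C) : is_contour g dg ->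
  side_integral g dg p vp -> side_integral g dg q vq -> p <> q ->
  is_contour_integral (fun y => / ((y - p) * (y - q))) g dg ((vp - vq) / (p - q)).
Proof.
  intros HC (Hp & wp & Hwp & Lp) (Hq & wq & Hwq & Lq) Hpq.
  destruct (contour_far g dg HC) as (T1 & HT1 & Hfar).
  destruct HC as (Hg & Hdg & _).
  unfold is_contour_integral. set (f := fun t => / ((g t - p) * (g t - q)) * dg t).
  set (w := fun T => / (p - q) * (wp T - wq T)).
  assert (Hc : forall t, filterlim f (locally t) (locally (f t))).
  { intros t. pose proof (continuous_of_is_derive_C g t _ (Hg t)) as Hgt.
    apply filterlim_C_mult; [|apply Hdg].
    apply filterlim_C_inv.
    - apply Cmult_neq_0; apply Csub_neq_0; auto.
    - apply filterlim_C_mult; apply filterlim_C_minus; auto; apply filterlim_const. }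
  assert (Hw : forall T, is_RInt (V := CR) f (- T) T (w T)).
  { intros T. unfold w.
    apply (is_RInt_ext (V := CR) (fun t => / (p - q) * (dg t / (g t - p) - dg t / (g t - q)))).
    - intros t _. unfold f. as_C. field. repeat split; apply Csub_neq_0; auto.
    - apply is_RInt_C_scal. apply (is_RInt_minus (V := CR)); auto. }
  assert (Hl : filterlim w (Rbar_locally p_infty) (locally ((vp - vq) / (p - q)))).
  { replace ((vp - vq) / (p - q)) with (/ (p - q) * (vp - vq)) by (unfold Cdiv; ring).
    apply filterlim_C_mult; [apply filterlim_const|]. now apply filterlim_C_minus. }
  set (R0 := (T1 + 2 * Cmod p + 2 * Cmod q)%R).
  pose proof (Cmod_ge_0 p). pose proof (Cmod_ge_0 q).
  assert (Hb : forall t, (t <= - R0)%R -> (Cmod (f t) <= 4 / t ^ 2)%R).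
  { intros t Ht. unfold R0 in Ht.
    assert (Et : Rabs t = (- t)%R) by (apply Rabs_left; lra).
    destruct (Hfar t ltac:(lra)) as [E1 E2].
    pose proof (far_lower_bound p t ltac:(lra)) as Bp.
    pose proof (far_lower_bound q t ltac:(lra)) as Bq.
    unfold f. rewrite E1, E2, Cmult_1_r, Cmod_inv, Cmod_mult.
    2:{ rewrite <- E1. apply Cmult_neq_0; apply Csub_neq_0; auto. }
    replace (4 / t ^ 2)%R with (/ (Rabs t / 2 * (Rabs t / 2)))%R by (rewrite Et; field; lra).
    apply Rinv_le_contravar; [nra|]. apply Rmult_le_compat; lra. }
  assert (HR0 : (0 < R0)%R) by (unfold R0; lra).
  apply is_RInt_gen_C_pair; try apply Rbar_locally_filter.
  - apply (is_RInt_gen_of_symmetric _ (fun T => fst (w T)) 4 R0); auto.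
    + intros t. apply (filterlim_C_fst f (f t)); auto.
    + intros t Ht. eapply Rle_trans; [apply Cmod_fst|auto].
    + intros T. apply (is_RInt_fct_extend_fst (U := R_NormedModule) (V := R_NormedModule) f), Hw.
    + apply (filterlim_C_fst w _ Hl).
  - apply (is_RInt_gen_of_symmetric _ (fun T => snd (w T)) 4 R0); auto.
    + intros t. apply (filterlim_C_snd f (f t)); auto.
    + intros t Ht. eapply Rle_trans; [apply Cmod_snd|auto].
    + intros T. apply (is_RInt_fct_extend_snd (U := R_NormedModule) (V := R_NormedModule) f), Hw.
    + apply (filterlim_C_snd w _ Hl).
Qed.

Lemma contour_inv_infty (g dg : R -> C) (p : C) (F : (R -> Prop) -> Prop) : is_contour g dg ->
  Filter F -> (forall B, F (fun t => (B < Rabs t)%R)) -> (forall t, g t <> p) ->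
  filterlim (fun t => / (g t - p)) F (locally (RtoC 0)).
Proof.
  intros HC HF HB Hp. destruct (contour_far g dg HC) as (T1 & HT1 & Hfar).
  apply filterlim_locally. intros eps.
  pose proof (Cmod_ge_0 p) as Hp0.
  assert (He : (0 < 2 / eps)%R) by (apply Rdiv_lt_0_compat; [lra|apply cond_pos]).
  generalize (HB (T1 + 2 * Cmod p + 2 / eps)%R). apply filter_imp. intros t Ht.
  destruct (Hfar t ltac:(lra)) as [E1 _].
  pose proof (far_lower_bound p t ltac:(lra)) as Bp.
  assert (Hm : (Cmod (/ (g t - p)) < eps)%R).
  { rewrite Cmod_inv by (apply Csub_neq_0; auto). rewrite E1.
    replace (pos eps) with (/ / eps)%R by (apply Rinv_inv).
    apply Rinv_lt_contravar.
    - apply Rmult_lt_0_compat; [apply Rinv_0_lt_compat, cond_pos|lra].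
    - unfold Rdiv in *. lra. }
  set (z := / (g t - p)) in *.
  split; (eapply Rle_lt_trans; [|exact Hm]).
  - change (Rabs (fst z - 0) <= Cmod z)%R. rewrite Rminus_0_r. apply Cmod_fst.
  - change (Rabs (snd z - 0) <= Cmod z)%R. rewrite Rminus_0_r. apply Cmod_snd.
Qed.

(** The primitive [-1/((k+1)(y-p)^(k+1))] is single-valued and vanishes at both ends of the
    contour. *)
Lemma contour_integral_power (g dg : R -> C) (p : C) (k : nat) : is_contour g dg ->
  (forall t, g t <> p) ->
  is_contour_integral (fun y => / (y - p) ^ (S (S k))) g dg 0.
Proof.
  intros HC Hp. pose proof HC as (Hg & Hdg & _).
  set (c := - / RtoC (INR (S k))).
  assert (Hk : RtoC (INR (S k)) <> 0).
  { intros H. apply RtoC_inj in H. apply (not_0_INR (S k)); auto. }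
  set (H := fun t => c * (/ (g t - p)) ^ S k).
  assert (Hn : forall t, g t - p <> 0) by (intros t; apply Csub_neq_0; auto).
  set (f := fun t => / (g t - p) ^ S (S k) * dg t).
  assert (Hd : forall t, is_derive (V := CR) H t (f t)).
  { intros t.
    assert (D0 : is_derive (V := CR) (fun s => g s - p) t (dg t)).
    { replace (dg t) with (minus (dg t : CR) (zero : CR)).
      - apply (is_derive_minus (V := CR)); [apply Hg|apply is_derive_const].
      - apply (minus_zero_r (G := CR)). }
    pose proof (is_derive_C_pow _ t _ k (is_derive_C_inv _ t _ (Hn t) D0)) as D1.
    pose proof (is_derive_C_mult (fun _ => c) _ t 0 _ (is_derive_const (V := CR) c t) D1) as D2.
    match type of D2 with is_derive _ _ ?l => replace (f t) with l; [exact D2|] end.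
    unfold f, c. rewrite <- Cpow_inv by auto. simpl Cpow. field. split; auto. }
  assert (Hc : forall t, filterlim f (locally t) (locally (f t))).
  { intros t. pose proof (continuous_of_is_derive_C g t _ (Hg t)) as Hgt.
    apply filterlim_C_mult; [|apply Hdg]. apply filterlim_C_inv; [now apply Cpow_nz|].
    apply filterlim_C_pow. apply filterlim_C_minus; auto. apply filterlim_const. }
  assert (HI : forall a b, is_RInt (V := CR) f a b (H b - H a)).
  { intros a b. apply (is_RInt_derive (V := C_R_CompleteNormedModule) H f); intros; [apply Hd|apply Hc]. }
  assert (HL : forall F, Filter F -> (forall B, F (fun t => (B < Rabs t)%R)) ->
    filterlim H F (locally (RtoC 0))).
  { intros F HF HB. replace (RtoC 0) with (c * 0 ^ S k) by (simpl; ring).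
    apply filterlim_C_mult; [apply filterlim_const|]. apply filterlim_C_pow.
    apply (contour_inv_infty g dg); auto. }
  assert (Hlim : filterlim (fun ab : R * R => H (snd ab) - H (fst ab))
     (filter_prod (Rbar_locally m_infty) (Rbar_locally p_infty)) (locally (RtoC 0))).
  { replace (RtoC 0) with (RtoC 0 - 0) by ring. apply filterlim_C_minus.
    - apply (filterlim_comp _ _ _ snd H _ (Rbar_locally p_infty)); [apply filterlim_snd|].
      apply HL; [apply Rbar_locally_filter|]. intros B. exists (Rmax B 0).
      intros t Ht. pose proof (Rmax_l B 0). pose proof (Rle_abs t). lra.
    - apply (filterlim_comp _ _ _ fst H _ (Rbar_locally m_infty)); [apply filterlim_fst|].
      apply HL; [apply Rbar_locally_filter|]. intros B. exists (- Rmax B 0)%R.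
      intros t Ht. pose proof (Rmax_l B 0). pose proof (Rle_abs (- t)). rewrite Rabs_Ropp in *. lra. }
  intros P HP. specialize (Hlim P HP). unfold filtermapi, filtermap in *.
  revert Hlim. apply filter_imp. intros [a b] Hab. exists (H b - H a). split; [apply HI|exact Hab].
Qed.

Lemma contour_integral_lin (g dg : R -> C) (c d u v : C) (f f' F : C -> C) :
  is_contour_integral f g dg u -> is_contour_integral f' g dg v ->
  (forall t, F (g t) = c * f (g t) + d * f' (g t)) ->
  is_contour_integral F g dg (c * u + d * v).
Proof.
  intros Hf Hf' E. unfold is_contour_integral in *.
  apply (is_RInt_gen_ext (V := CR) (fun t => plus (c * (f (g t) * dg t) : CR) (d * (f' (g t) * dg t)))).
  - apply filter_forall. intros ab t _. rewrite E. unfold plus; simpl.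
    change (c * (f (g t) * dg t) + d * (f' (g t) * dg t)
      = (c * f (g t) + d * f' (g t)) * dg t). ring.
  - apply (is_RInt_gen_plus (V := CR)); apply is_RInt_gen_C_scal; auto;
      apply Rbar_locally_filter.
Qed.

Lemma contour_integral_ext (g dg : R -> C) (v : C) (f F : C -> C) :
  is_contour_integral f g dg v -> (forall t, F (g t) = f (g t)) -> is_contour_integral F g dg v.
Proof.
  intros Hf E. replace v with (1 * v + 0 * v) by ring.
  apply (contour_integral_lin g dg 1 0 v v f f); auto. intros t. rewrite E. ring.
Qed.

Lemma all_equal_or_split (p : C) (D : list C) :
  (forall q, In q D -> q = p) \/ exists q D', q <> p /\ Permutation D (q :: D').
Proof.
  induction D as [|r D IH].
  - left. intros q [].
  - destruct (Ceq_dec r p) as [->|Hr].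
    + destruct IH as [IH|(q & D' & Hq & HP)].
      * left. intros q [<-|Hq]; auto.
      * right. exists q, (p :: D'). split; auto.
        rewrite HP. apply perm_swap.
    + right. exists r, D. auto.
Qed.

Lemma lprod_all_equal (p : C) (D : list C) (y : C) :
  (forall q, In q D -> q = p) -> lprod D y = (y - p) ^ length D.
Proof.
  induction D as [|q D IH]; intros H; simpl; auto.
  rewrite (H q), IH; auto; simpl; auto. intros; apply H; simpl; auto.
Qed.

Lemma lprod_contour_neq_0 (g dg : R -> C) (v : C) (D : list C) (t : R) :
  (forall p, In p D -> side_integral g dg p v) -> lprod D (g t) <> 0.
Proof.
  intros H. apply lprod_neq_0. intros Hin. destruct (H _ Hin) as [Hne _]. now apply (Hne t).
Qed.

(** Poles may be repeated. Either all are equal and a primitive exists, or two of them differ and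
    splitting [1/((y-p)(y-q))] leaves fewer poles, with two pairs of equal values at the bottom. *)
Lemma same_side_inv (g dg : R -> C) (v : C) (D : list C) : is_contour g dg ->
  (forall p, In p D -> side_integral g dg p v) ->
  (2 <= length D)%nat -> is_contour_integral (fun y => / lprod D y) g dg 0.
Proof.
  intros HC. remember (length D) as k eqn:Ek. revert D Ek.
  induction k as [k IH] using lt_wf_ind. intros D Ek HD Hk.
  destruct D as [|p D]; simpl in Ek; [lia|].
  destruct (all_equal_or_split p D) as [Heq|(q & D' & Hqp & HP)].
  - destruct D as [|r D]; simpl in Ek; [lia|].
    apply (contour_integral_ext _ _ _ (fun y => / (y - p) ^ S (S (length D)))).
    + apply contour_integral_power; auto. intros t. apply (HD p). simpl; auto.
    + intros t. rewrite (lprod_all_equal p); auto.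
      intros q [<-|Hq]; auto.
  - assert (HP' : Permutation (p :: D) (p :: q :: D')) by (constructor; auto).
    assert (HD' : forall r, In r (p :: q :: D') -> side_integral g dg r v).
    { intros r Hr. apply HD. now apply (Permutation_in _ (Permutation_sym HP')). }
    pose proof (HD' p ltac:(simpl; auto)) as Sp.
    pose proof (HD' q ltac:(simpl; auto)) as Sq.
    apply Permutation_length in HP as HL. simpl in HL.
    destruct D' as [|r D'].
    + replace (RtoC 0) with ((v - v) / (p - q)) by (field; apply Csub_neq_0; auto).
      apply (contour_integral_ext _ _ _ (fun y => / ((y - p) * (y - q)))).
      * now apply contour_integral_pair; auto.
      * intros t. rewrite (lprod_perm _ _ _ HP'). simpl. f_equal. ring.
    + replace (RtoC 0) with (/ (p - q) * 0 + - / (p - q) * 0) by ring.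
      apply (contour_integral_lin g dg _ _ 0 0 (fun y => / lprod (p :: r :: D') y)
        (fun y => / lprod (q :: r :: D') y)).
      * apply (IH (length (p :: r :: D'))); simpl in *; try lia; auto;
          intros; apply HD'; intuition.
      * apply (IH (length (q :: r :: D'))); simpl in *; try lia; auto;
          intros; apply HD'; intuition.
      * intros t. rewrite (lprod_perm _ _ _ HP').
        assert (lprod (r :: D') (g t) <> 0)
          by (apply (lprod_contour_neq_0 g dg v); intros; apply HD'; simpl in *; intuition).
        cbn [lprod fold_right]. fold (lprod D' (g t)).
        change ((g t - r) * lprod D' (g t)) with (lprod (r :: D') (g t)).
        field. repeat split; auto; apply Csub_neq_0; auto; [apply Sq|apply Sp].
Qed.

(** The numerator is removed by [y - z = (y - p) + (p - z)], as in [dd_mul_linear]. *)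
Lemma same_side_integral (g dg : R -> C) (v : C) (Z : list C) : is_contour g dg -> forall D : list C,
  (forall p, In p D -> side_integral g dg p v) ->
  (length Z + 2 <= length D)%nat ->
  is_contour_integral (fun y => lprod Z y / lprod D y) g dg 0.
Proof.
  intros HC. induction Z as [|z Z IH]; intros D HD HL; simpl in HL.
  - apply (contour_integral_ext _ _ _ (fun y => / lprod D y)).
    + apply (same_side_inv g dg v); auto.
    + intros t. simpl. unfold Cdiv. ring.
  - destruct D as [|p D]; simpl in HL; [lia|].
    replace (RtoC 0) with (1 * 0 + (p - z) * 0) by ring.
    apply (contour_integral_lin g dg _ _ 0 0 (fun y => lprod Z y / lprod D y)
      (fun y => lprod Z y / lprod (p :: D) y)).
    + apply IH; [|lia]. intros; apply HD; simpl; auto.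
    + apply IH; [|simpl; lia]. auto.
    + intros t.
      assert (lprod D (g t) <> 0)
        by (apply (lprod_contour_neq_0 g dg v); intros; apply HD; simpl; auto).
      simpl. field. split; auto. apply Csub_neq_0, (HD p); simpl; auto.
Qed.

(* Families of points depending on a perturbation parameter [e], evaluated at [e]. *)
Definition ev (e : R) (l : list (R -> C)) : list C := map (fun f => f e) l.

Definition cv0 (f : R -> C) : Prop := filterlim f (at_right 0) (locally (f 0%R)).

Lemma cv0_const (c : C) : cv0 (fun _ => c).
Proof. apply filterlim_const. Qed.

Lemma cv0_plus (f g : R -> C) : cv0 f -> cv0 g -> cv0 (fun e => f e + g e).
Proof. apply filterlim_C_plus. Qed.

Lemma cv0_minus (f g : R -> C) : cv0 f -> cv0 g -> cv0 (fun e => f e - g e).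
Proof. apply filterlim_C_minus. Qed.

Lemma cv0_mult (f g : R -> C) : cv0 f -> cv0 g -> cv0 (fun e => f e * g e).
Proof. apply filterlim_C_mult. Qed.

Lemma cv0_inv (f : R -> C) : f 0%R <> 0 -> cv0 f -> cv0 (fun e => / f e).
Proof. apply filterlim_C_inv. Qed.

(** This can fail at [e = 0], where plus poles may coincide; there the integral is reached only as a
    limit. *)
Definition separated (e : R) (U L : list (R -> C)) : Prop :=
  NoDup (ev e U) /\ forall p q, In p (ev e U) -> In q (ev e L) -> p <> q.

(** The same principal value would have the two limits [i pi] and [- i pi]. *)
Lemma left_right_neq (g dg : R -> C) (p q : C) :
  left_of g dg p -> right_of g dg q -> p <> q.
Proof.
  intros (_ & w & Hw & Lw) (_ & w' & Hw' & Lw') <-.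
  assert (E : (0%R, PI) = (0%R, (- PI)%R) :> C).
  { apply (filterlim_locally_unique (F := Rbar_locally p_infty) (V := CR) w); auto.
    apply (filterlim_ext w'); auto. intros T.
    rewrite <- (is_RInt_unique (V := C_R_CompleteNormedModule) _ _ _ _ (Hw T)).
    symmetry. apply (is_RInt_unique (V := C_R_CompleteNormedModule)), Hw'. }
  injection E. pose proof PI_RGT_0. lra.
Qed.

(** One partial-fraction recursion is run on the integral at [e = 0] and on the divided difference
    at nearby [e]. It divides only by [p - q] with [p] in [U] and [q] in [L], nonzero at 0 by
    [left_right_neq], so [v] is continuous there even when points of [U] merge. With [U] or [L]
    empty, both quantities vanish. *)
Lemma contour_integral_family (g dg : R -> C) (Z U L : list (R -> C)) : is_contour g dg ->
  (forall f, In f Z \/ In f U \/ In f L -> cv0 f) ->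
  (forall p, In p U -> left_of g dg (p 0%R)) ->
  (forall q, In q L -> right_of g dg (q 0%R)) ->
  (length Z + 2 <= length U + length L)%nat ->
  exists v : R -> C, cv0 v /\
    is_contour_integral (fun y => lprod (ev 0 Z) y / (lprod (ev 0 U) y * lprod (ev 0 L) y)) g dg
      (2 * RtoC PI * Ci * v 0%R) /\
    forall e, separated e U L ->
      v e = dd (ev e U) (fun y => lprod (ev e Z) y / lprod (ev e L) y).
Proof.
  intros HC.
  remember (length Z + length U + length L)%nat as k eqn:Ek. revert Z U L Ek.
  induction k as [k IH] using lt_wf_ind. intros Z U L Ek Hcv HU HL Hlen.
  assert (HU' : forall p, In p (ev 0 U) -> left_of g dg p).
  { intros p Hp. apply in_map_iff in Hp. destruct Hp as (f & <- & Hf). auto. }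
  assert (HL' : forall p, In p (ev 0 L) -> right_of g dg p).
  { intros p Hp. apply in_map_iff in Hp. destruct Hp as (f & <- & Hf). auto. }
  destruct U as [|p U].
  { exists (fun _ => RtoC 0). split; [apply cv0_const|]. split; [|reflexivity].
    rewrite Cmult_0_r.
    apply (contour_integral_ext _ _ _ (fun y => lprod (ev 0 Z) y / lprod (ev 0 L) y)).
    - apply (same_side_integral g dg _ _ HC _ HL'). unfold ev. rewrite !length_map. simpl in Hlen. lia.
    - intros t. simpl. now rewrite Cmult_1_l. }
  destruct L as [|q L].
  { exists (fun _ => RtoC 0). split; [apply cv0_const|]. split.
    - rewrite Cmult_0_r.
      apply (contour_integral_ext _ _ _ (fun y => lprod (ev 0 Z) y / lprod (ev 0 (p :: U)) y)).
      + apply (same_side_integral g dg _ _ HC _ HU'). unfold ev. rewrite !length_map. simpl in *. lia.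
      + intros t. simpl. now rewrite Cmult_1_r.
    - intros e [HN _].
      assert (Hdeg : dd_degree_le (length Z) (fun y => lprod (ev e Z) y / lprod (ev e nil) y)).
      { clear. induction Z as [|z Z IHZ].
        - apply (dd_degree_ext 0 0 (fun _ => 1)); [apply dd_degree_cst|lia|].
          intros y. simpl. field.
        - apply (dd_degree_ext _ _ _ _ (dd_degree_mul _ 1 (z e) _ IHZ)); [simpl; lia|].
          intros y. simpl. field. }
      symmetry. apply Hdeg; auto. unfold ev. rewrite length_map. simpl in *. lia. }
  assert (Hpq : p 0%R - q 0%R <> 0).
  { apply Csub_neq_0. apply (left_right_neq g dg); [apply HU|apply HL]; simpl; auto. }
  assert (Hnz : forall t, g t - p 0%R <> 0 /\ g t - q 0%R <> 0 /\
     lprod (ev 0 U) (g t) <> 0 /\ lprod (ev 0 L) (g t) <> 0).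
  { intros t. repeat split.
    - apply Csub_neq_0, (HU p). simpl; auto.
    - apply Csub_neq_0, (HL q). simpl; auto.
    - apply (lprod_contour_neq_0 g dg ((0%R, PI) : C)). intros r Hr. apply HU'. simpl; auto.
    - apply (lprod_contour_neq_0 g dg ((0%R, (- PI)%R) : C)). intros r Hr. apply HL'. simpl; auto. }
  assert (Cp : cv0 p) by (apply Hcv; simpl; auto).
  assert (Cq : cv0 q) by (apply Hcv; simpl; auto).
  assert (Cd : cv0 (fun e => / (p e - q e))) by (apply cv0_inv; auto; apply cv0_minus; auto).
  destruct Z as [|z Z].
  - assert (Eqn : forall e, separated e (p :: U) (q :: L) ->
      dd (ev e (p :: U)) (fun y => lprod (ev e nil) y / lprod (ev e (q :: L)) y) =
      / (p e - q e) * (dd (ev e (p :: U)) (fun y => lprod (ev e nil) y / lprod (ev e L) y)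
        - dd (ev e U) (fun y => lprod (ev e nil) y / lprod (ev e (q :: L)) y))).
    { intros e [HN HS]. cbn [ev map] in *. fold (ev e U) in *. fold (ev e L) in *.
      inversion_clear HN as [|? ? Hp HN'].
      assert (Hpq' : p e - q e <> 0) by (apply Csub_neq_0, HS; simpl; auto).
      rewrite <- (dd_cancel (p e) (ev e U)) by auto.
      rewrite (dd_ext (p e :: ev e U) (fun y => lprod nil y / lprod (ev e L) y)
        (fun y => (p e - q e) * (lprod nil y / lprod (q e :: ev e L) y)
          + 1 * ((y - p e) * (lprod nil y / lprod (q e :: ev e L) y)))).
      - rewrite dd_lin. field. auto.
      - intros y Hy. simpl. field. split.
        + apply lprod_neq_0. intros Hin. apply (HS y y); simpl; auto.
        + apply Csub_neq_0, HS; simpl; auto. }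
    (* One pole on each side is the base case: splitting further would leave single simple poles,
       whose integrals do not converge. Its value comes from [i pi - (- i pi) = 2 pi i]. *)
    destruct (Nat.eq_dec (length U + length L) 0) as [E0|E0].
    + destruct U; [|simpl in E0; lia]. destruct L; [|simpl in E0; lia].
      exists (fun e => / (p e - q e)). split; [auto|]. split.
      * apply (contour_integral_ext _ _ _ (fun y => / ((y - p 0%R) * (y - q 0%R)))).
        -- replace (2 * RtoC PI * Ci * / (p 0%R - q 0%R))
             with ((((0%R, PI) : C) - (0%R, (- PI)%R)) / (p 0%R - q 0%R)).
           ++ apply contour_integral_pair; auto; [apply HU|apply HL|]; simpl; auto.
              intros E. apply Hpq. rewrite E. ring.
           ++ unfold Cdiv. f_equal. apply injective_projections; simpl; ring.
        -- intros t. simpl. rewrite !Cmult_1_r. unfold Cdiv. ring.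
      * intros e HS. destruct HS as [_ HS]. simpl. field. 
        apply Csub_neq_0, HS; simpl; auto.
    + destruct (IH (length (@nil (R -> C)) + length (p :: U) + length L)%nat ltac:(simpl in *; lia)
        nil (p :: U) L eq_refl) as (v1 & Cv1 & I1 & D1); auto.
      { intros f Hf. apply Hcv. simpl in *. intuition. }
      { intros; apply HL; simpl; auto. }
      { simpl in *. lia. }
      destruct (IH (length (@nil (R -> C)) + length U + length (q :: L))%nat ltac:(simpl in *; lia)
        nil U (q :: L) eq_refl) as (v2 & Cv2 & I2 & D2); auto.
      { intros f Hf. apply Hcv. simpl in *. intuition. }
      { intros; apply HU; simpl; auto. }
      { simpl in *. lia. }
      exists (fun e => / (p e - q e) * (v1 e - v2 e)). split; [|split].
      * apply cv0_mult; auto. apply cv0_minus; auto.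
      * replace (2 * RtoC PI * Ci * (/ (p 0%R - q 0%R) * (v1 0%R - v2 0%R)))
          with (/ (p 0%R - q 0%R) * (2 * RtoC PI * Ci * v1 0%R)
            + - / (p 0%R - q 0%R) * (2 * RtoC PI * Ci * v2 0%R)) by ring.
        refine (contour_integral_lin g dg _ _ _ _ _ _ _ I1 I2 _).
        intros t. destruct (Hnz t) as (A1 & A2 & A3 & A4). simpl. fold (ev 0 U). fold (ev 0 L).
        field. auto.
      * intros e HS. rewrite Eqn by auto. destruct HS as [HN HS].
        rewrite <- D1, <- D2; auto.
        -- split; [now inversion HN|]. intros; apply HS; simpl in *; auto.
        -- split; auto. intros; apply HS; simpl in *; auto.
  - destruct (IH (length Z + length U + length (q :: L))%nat ltac:(simpl in *; lia)
        Z U (q :: L) eq_refl) as (v1 & Cv1 & I1 & D1); auto.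
    { intros f Hf. apply Hcv. simpl in *. intuition. }
    { intros; apply HU; simpl; auto. }
    { simpl in *. lia. }
    destruct (IH (length Z + length (p :: U) + length (q :: L))%nat ltac:(simpl in *; lia)
        Z (p :: U) (q :: L) eq_refl) as (v2 & Cv2 & I2 & D2); auto.
    { intros f Hf. apply Hcv. simpl in *. intuition. }
    { simpl in *. lia. }
    exists (fun e => v1 e + (p e - z e) * v2 e). split; [|split].
    + apply cv0_plus; auto. apply cv0_mult; auto. apply cv0_minus; auto. apply Hcv. simpl; auto.
    + replace (2 * RtoC PI * Ci * (v1 0%R + (p 0%R - z 0%R) * v2 0%R))
        with (1 * (2 * RtoC PI * Ci * v1 0%R)
          + (p 0%R - z 0%R) * (2 * RtoC PI * Ci * v2 0%R)) by ring.
      refine (contour_integral_lin g dg _ _ _ _ _ _ _ I1 I2 _).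
      intros t. destruct (Hnz t) as (A1 & A2 & A3 & A4). simpl. fold (ev 0 U). fold (ev 0 L).
      fold (ev 0 Z). field. auto.
    + intros e HS. destruct HS as [HN HS].
      rewrite D1, D2; [|split; auto|split; [now inversion HN|intros; apply HS; simpl in *; auto]].
      cbn [ev map]. fold (ev e U). fold (ev e L). fold (ev e Z).
      rewrite <- dd_mul_linear by now inversion HN.
      apply dd_ext. intros y _. simpl. unfold Cdiv. ring.
Qed.

(** * Factorization of the integrand *)

Definition Zpl (x : C) (s : Z) : list C :=
  map (fun i => - x + RtoC (IZR (s - 2 - 2 * Z.of_nat i))) (seq 0 (Z.to_nat (s - 1))).

Definition cpl (s : Z) : C :=
  if (s <=? 0)%Z then RtoC 2 ^ Z.to_nat (1 - s) else (/ 2) ^ Z.to_nat (s - 1).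

(** Replacing [y] by [- y] negates every linear factor; the two powers of [-1] collect these signs
    from the zeros and from the poles. *)
Definition cmi (s : Z) : C :=
  cpl s * (- (1)) ^ Z.to_nat (s - 1) * / (- (1)) ^ Z.to_nat (1 - s).

Lemma lprod_map_seq (z : nat -> C) (k : nat) (y : C) :
  lprod (map z (seq 0 k)) y = prodC k (fun i => y - z i).
Proof.
  induction k as [|k IH]; [reflexivity|].
  rewrite seq_S, map_app, lprod_app, IH. simpl. ring.
Qed.

Lemma prodC_cst (k : nat) (c : C) (f : nat -> C) : prodC k (fun i => c * f i) = c ^ k * prodC k f.
Proof. induction k as [|k IH]; simpl; [ring|rewrite IH; ring]. Qed.

Lemma regpl_zeros (x : C) (s : Z) (y : C) : regpl x s y = cpl s * lprod (Zpl x s) y.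
Proof.
  unfold regpl, cpl. destruct (Z.leb_spec s 0).
  - unfold Zpl. replace (Z.to_nat (s - 1)) with 0%nat by lia. simpl lprod. ring.
  - unfold gam, Zpl. rewrite <- (Z2Nat.id (s - 1)) at 1 by lia.
    rewrite poch_nat, lprod_map_seq, <- prodC_cst. apply prodC_ext. intros i _.
    rewrite INR_IZR_INZ. push_IZR. field.
Qed.

Lemma gam_plus_form (x : C) (s : Z) (y : C) :
  gam (x + y) s = regpl x s y * / lprod (Upl x s) y.
Proof.
  unfold regpl. destruct (Z.leb_spec s 0).
  - unfold gam, Upl. set (k := Z.to_nat (1 - s)).
    replace (s - 1)%Z with (- Z.of_nat k)%Z by lia.
    rewrite poch_neg, lprod_map_seq.
    rewrite (prodC_ext k _ (fun i => / 2 * (y - (- x + RtoC (IZR (s + 2 * Z.of_nat i)))))).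
    + rewrite prodC_cst, Cinv_mult. f_equal. rewrite Cpow_inv by exact C2_neq_0.
      field. apply Cpow_nz, C2_neq_0.
    + intros i _. rewrite INR_IZR_INZ, Nat2Z.inj_succ. unfold Z.succ. push_IZR. field.
  - rewrite Upl_nil by lia. simpl lprod. field.
Qed.

Lemma lprod_opp (l : list C) (y : C) :
  lprod l (- y) = (- (1)) ^ length l * lprod (map Copp l) y.
Proof. induction l as [|p l IH]; simpl; [ring|rewrite IH; ring]. Qed.

Lemma gam_minus_form (x : C) (s : Z) (y : C) :
  gam (x - y) s = cmi s * lprod (map Copp (Zpl x s)) y * / lprod (map Copp (Upl x s)) y.
Proof.
  change (x - y) with (x + - y). rewrite gam_plus_form, regpl_zeros, !lprod_opp, Cinv_mult.
  unfold cmi, Zpl, Upl. rewrite !length_map, !length_seq. ring.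
Qed.

Lemma lprod_flat_map (f : nat -> list C) (ks : list nat) (y : C) :
  lprod (flat_map f ks) y = prodL ks (fun k => lprod (f k) y).
Proof.
  induction ks as [|k ks IH]; [reflexivity|]. simpl. now rewrite lprod_app, IH.
Qed.

Lemma prodC_inv (k : nat) (f : nat -> C) : prodC k (fun i => / f i) = / prodC k f.
Proof. induction k as [|k IH]; simpl; [field|now rewrite IH, Cinv_mult]. Qed.

Definition lowers (a : nat -> C) (d : nat -> Z) (ks : list nat) : list C :=
  flat_map (fun k => map Copp (Upl (a k) (d k))) ks.

Definition zeros (a : nat -> C) (n : nat -> Z) (h m : Z) : list C :=
  Nc h m :: (- Nc h m) :: flat_map (fun k => Zpl (a k) (plidx n h m k)) (seq 0 6)
    ++ flat_map (fun k => map Copp (Zpl (a k) (n k - m))) (seq 0 6).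

Definition cst (n : nat -> Z) (h m : Z) : C :=
  prodC 6 (fun k => cpl (plidx n h m k) * cmi (n k - m)).

Lemma regular_part_form (a : nat -> C) (n : nat -> Z) (h m : Z) (y : C) :
  (y * y - Nc h m * Nc h m) *
    prodC 6 (fun k => regpl (a k) (plidx n h m k) y * gam (a k - y) (n k - m)) =
  cst n h m * (lprod (zeros a n h m) y / lprod (lowers a (fun k => (n k - m)%Z) (seq 0 6)) y).
Proof.
  unfold zeros, lowers. cbn [lprod fold_right]. fold (lprod (flat_map
    (fun k => Zpl (a k) (plidx n h m k)) (seq 0 6)
    ++ flat_map (fun k => map Copp (Zpl (a k) (n k - m))) (seq 0 6)) y).
  rewrite lprod_app, !lprod_flat_map, !prodL_seq6.
  unfold Cdiv. rewrite <- prodC_inv.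
  rewrite (prodC_ext 6 _ (fun k => (cpl (plidx n h m k) * cmi (n k - m)) *
    (lprod (Zpl (a k) (plidx n h m k)) y * lprod (map Copp (Zpl (a k) (n k - m))) y *
     / lprod (map Copp (Upl (a k) (n k - m))) y))).
  - rewrite (prodC_mult 6 (fun k => cpl (plidx n h m k) * cmi (n k - m))). fold (cst n h m).
    rewrite !prodC_mult. ring.
  - intros k _. rewrite gam_minus_form, regpl_zeros. ring.
Qed.

Lemma shiftC_Nc (half : bool) (m : Z) : shiftC half m = Nc (twonu half) m.
Proof.
  unfold shiftC, Nc, nuR, twonu. destruct half; rewrite RtoC_plus; [|field].
  rewrite RtoC_inv by lra. field.
Qed.

Lemma plus_factor (half : bool) (a : nat -> C) (n : nat -> Z) (m : Z) (k : nat) (y : C) :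
  plus_arg half a n m k y =
  1 + (a k + y - RtoC (IZR (plidx n (twonu half) m k))) / 2.
Proof.
  unfold plus_arg, plidx. rewrite !shiftC_Nc. unfold Nc. push_IZR. field.
Qed.

Lemma minus_factor (half : bool) (a : nat -> C) (n : nat -> Z) (m : Z) (k : nat) (y : C) :
  minus_arg half a n m k y = 1 + (a k - y - RtoC (IZR (n k - m))) / 2.
Proof.
  unfold minus_arg. rewrite !shiftC_Nc. unfold Nc. push_IZR. field.
Qed.

Lemma FN_form (half : bool) (a : nat -> C) (n : nat -> Z) (m : Z) (y : C) :
  FN half a n m y = cst n (twonu half) m * (lprod (zeros a n (twonu half) m) y /
    (lprod (nodes a (plidx n (twonu half) m) (seq 0 6)) y *
     lprod (lowers a (fun k => (n k - m)%Z) (seq 0 6)) y)).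
Proof.
  set (h := twonu half).
  transitivity ((y * y - Nc h m * Nc h m) *
    prodC 6 (fun k => regpl (a k) (plidx n h m k) y * gam (a k - y) (n k - m))
    * / lprod (nodes a (plidx n h m) (seq 0 6)) y).
  - unfold FN, nodes. rewrite shiftC_Nc. fold h. rewrite <- Cmult_assoc. f_equal.
    rewrite lprod_flat_map, prodL_seq6, <- prodC_inv, <- prodC_mult. apply prodC_ext.
    intros k _. rewrite plus_factor, minus_factor. fold h.
    change (poch (1 + (a k + y - RtoC (IZR (plidx n h m k))) / 2) (plus_idx half n m k))
      with (gam (a k + y) (plidx n h m k)).
    change (poch (1 + (a k - y - RtoC (IZR (n k - m))) / 2) (minus_idx n m k))
      with (gam (a k - y) (n k - m)).
    rewrite gam_plus_form. ring.
  - rewrite regular_part_form. unfold Cdiv. rewrite Cinv_mult. ring.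
Qed.

(** * Perturbation to generic parameters *)

Definition Uplf (x : R -> C) (s : Z) : list (R -> C) :=
  map (fun i e => - x e + RtoC (IZR (s + 2 * Z.of_nat i))) (seq 0 (Z.to_nat (1 - s))).
Definition Zplf (x : R -> C) (s : Z) : list (R -> C) :=
  map (fun i e => - x e + RtoC (IZR (s - 2 - 2 * Z.of_nat i))) (seq 0 (Z.to_nat (s - 1))).
Definition Coppf (f : R -> C) (e : R) : C := - f e.

Lemma ev_flat_map (f : nat -> list (R -> C)) (ks : list nat) (e : R) :
  ev e (flat_map f ks) = flat_map (fun k => ev e (f k)) ks.
Proof.
  unfold ev. now rewrite !flat_map_concat_map, concat_map, map_map.
Qed.

Lemma ev_Uplf (x : R -> C) (s : Z) (e : R) : ev e (Uplf x s) = Upl (x e) s.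
Proof. unfold ev, Uplf. now rewrite map_map. Qed.

Lemma ev_Zplf (x : R -> C) (s : Z) (e : R) : ev e (Zplf x s) = Zpl (x e) s.
Proof. unfold ev, Zplf. now rewrite map_map. Qed.

Lemma ev_Coppf (l : list (R -> C)) (e : R) : ev e (map Coppf l) = map Copp (ev e l).
Proof. unfold ev. now rewrite !map_map. Qed.

Lemma cv0_Coppf (f : R -> C) : cv0 f -> cv0 (Coppf f).
Proof. apply filterlim_C_opp. Qed.

Lemma cv0_Uplf (x : R -> C) (s : Z) (f : R -> C) : cv0 x -> In f (Uplf x s) -> cv0 f.
Proof.
  intros Hx H. apply in_map_iff in H. destruct H as (i & <- & _).
  apply cv0_plus; [apply cv0_Coppf; auto|apply cv0_const].
Qed.

Lemma cv0_Zplf (x : R -> C) (s : Z) (f : R -> C) : cv0 x -> In f (Zplf x s) -> cv0 f.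
Proof.
  intros Hx H. apply in_map_iff in H. destruct H as (i & <- & _).
  apply cv0_plus; [apply cv0_Coppf; auto|apply cv0_const].
Qed.

Lemma Upl_pole (x : C) (s : Z) (p : C) : In p (Upl x s) ->
  (s - 1 < 0)%Z /\ exists j : nat, (1 <= j)%nat /\ (Z.of_nat j <= - (s - 1))%Z /\
    1 + (x + p - RtoC (IZR s)) / 2 = RtoC (INR j).
Proof.
  intros H. apply in_map_iff in H. destruct H as (i & <- & Hi). apply in_seq in Hi.
  split; [lia|]. exists (S i). split; [lia|]. split; [lia|].
  rewrite INR_IZR_INZ, Nat2Z.inj_succ. unfold Z.succ. push_IZR. field.
Qed.

Lemma length_flat_map_to_nat (n : nat -> Z) (f : nat -> list (R -> C)) (ks : list nat) :
  (forall k, length (f k) = Z.to_nat (n k)) ->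
  length (flat_map f ks) = fold_right (fun k l => (Z.to_nat (n k) + l)%nat) 0%nat ks.
Proof.
  intros H. induction ks as [|k ks IH]; [reflexivity|]. simpl. now rewrite length_app, IH, H.
Qed.

Lemma Z_to_nat_opp (z : Z) :
  (Z.of_nat (Z.to_nat (1 - z)) = 1 - z + Z.of_nat (Z.to_nat (z - 1)))%Z.
Proof. lia. Qed.

(** [v] joins the contour integral at the given parameters to the residue sum at perturbed ones. *)
Lemma FN_integral_family (half : bool) (a : nat -> C) (n : nat -> Z) (m : Z) (g dg : R -> C)
    (af : nat -> R -> C) :
  (sum6 n + 3 * twonu half = 2)%Z -> separating_contour half a n m g dg ->
  (forall k, cv0 (af k)) -> (forall k, af k 0%R = a k) ->
  exists v : R -> C, cv0 v /\
    is_contour_integral (FN half a n m) g dg (2 * RtoC PI * Ci * v 0%R) /\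
    forall e, generic (fun k => af k e) -> v e = Jm (fun k => af k e) n (twonu half) m.
Proof.
  set (h := twonu half). intros Hn (HC & HPl & HMi) Haf Ha0.
  assert (E0 : (fun k => af k 0%R) = a) by (apply functional_extensionality; auto).
  set (s := plidx n h m). set (d := fun k => (n k - m)%Z).
  set (U := flat_map (fun k => Uplf (af k) (s k)) (seq 0 6)).
  set (L := flat_map (fun k => map Coppf (Uplf (af k) (d k))) (seq 0 6)).
  set (Z := (fun _ => Nc h m) :: (fun _ => - Nc h m) ::
     flat_map (fun k => Zplf (af k) (s k)) (seq 0 6)
     ++ flat_map (fun k => map Coppf (Zplf (af k) (d k))) (seq 0 6)).
  assert (EU : forall e, ev e U = nodes (fun k => af k e) s (seq 0 6)).
  { intros e. unfold U. rewrite ev_flat_map. apply flat_map_ext. intros k. apply ev_Uplf. }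
  assert (EL : forall e, ev e L = lowers (fun k => af k e) d (seq 0 6)).
  { intros e. unfold L. rewrite ev_flat_map. apply flat_map_ext. intros k.
    rewrite ev_Coppf, ev_Uplf. reflexivity. }
  assert (EZ : forall e, ev e Z = zeros (fun k => af k e) n h m).
  { intros e. unfold Z, zeros. unfold ev at 1. cbn [map]. do 2 f_equal. rewrite map_app.
    change (map (fun f : R -> C => f e)) with (ev e). rewrite !ev_flat_map. f_equal.
    - apply flat_map_ext. intros k. apply ev_Zplf.
    - apply flat_map_ext. intros k. rewrite ev_Coppf, ev_Zplf. reflexivity. }
  destruct (contour_integral_family g dg Z U L HC) as (v & Cv & Iv & Dv).
  - intros f [Hf|[Hf|Hf]].
    + destruct Hf as [<-|[<-|Hf]]; try apply cv0_const.
      apply in_app_iff in Hf. destruct Hf as [Hf|Hf]; apply in_flat_map in Hf;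
        destruct Hf as (k & _ & Hf).
      * eapply cv0_Zplf; eauto.
      * apply in_map_iff in Hf. destruct Hf as (f' & <- & Hf).
        apply cv0_Coppf. eapply cv0_Zplf; eauto.
    + apply in_flat_map in Hf. destruct Hf as (k & _ & Hf). eapply cv0_Uplf; eauto.
    + apply in_flat_map in Hf. destruct Hf as (k & _ & Hf).
      apply in_map_iff in Hf. destruct Hf as (f' & <- & Hf).
      apply cv0_Coppf. eapply cv0_Uplf; eauto.
  - intros p Hp. apply in_flat_map in Hp. destruct Hp as (k & Hk & Hp). apply in_seq in Hk.
    apply (in_map (fun f => f 0%R)) in Hp. fold (ev 0 (Uplf (af k) (s k))) in Hp.
    rewrite ev_Uplf, Ha0 in Hp. apply Upl_pole in Hp. destruct Hp as (Hs & j & Hj1 & Hj2 & Hj).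
    apply (HPl k); [lia|]. split; [exact Hs|]. exists j. split; [auto|split; [exact Hj2|]].
    rewrite plus_factor. exact Hj.
  - intros q Hq. apply in_flat_map in Hq. destruct Hq as (k & Hk & Hq). apply in_seq in Hk.
    apply in_map_iff in Hq. destruct Hq as (p & <- & Hp).
    apply (in_map (fun f => f 0%R)) in Hp. fold (ev 0 (Uplf (af k) (d k))) in Hp.
    rewrite ev_Uplf, Ha0 in Hp. apply Upl_pole in Hp. destruct Hp as (Hs & j & Hj1 & Hj2 & Hj).
    apply (HMi k); [lia|]. split; [exact Hs|]. exists j. split; [auto|split; [exact Hj2|]].
    rewrite minus_factor. rewrite <- Hj. unfold Coppf, d. field.
  (* Degree count: the denominator exceeds the numerator by [sum (2 - s_k - d_k) - 2 = 12 - 2 sum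
     N_k - 2 = 6]. *)
  - unfold Z, U, L. cbn [length]. rewrite length_app.
    rewrite (length_flat_map_to_nat (fun k => (s k - 1)%Z) (fun k => Zplf _ _)),
      (length_flat_map_to_nat (fun k => (d k - 1)%Z) (fun k => map _ (Zplf _ _))),
      (length_flat_map_to_nat (fun k => (1 - s k)%Z) (fun k => Uplf _ _)),
      (length_flat_map_to_nat (fun k => (1 - d k)%Z) (fun k => map _ (Uplf _ _)));
      try (intros k; unfold Uplf, Zplf; now rewrite ?length_map, length_seq).
    cbn [seq fold_right].
    pose proof (Z_to_nat_opp (s 0%nat)). pose proof (Z_to_nat_opp (d 0%nat)).
    pose proof (Z_to_nat_opp (s 1%nat)). pose proof (Z_to_nat_opp (d 1%nat)).
    pose proof (Z_to_nat_opp (s 2%nat)). pose proof (Z_to_nat_opp (d 2%nat)).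
    pose proof (Z_to_nat_opp (s 3%nat)). pose proof (Z_to_nat_opp (d 3%nat)).
    pose proof (Z_to_nat_opp (s 4%nat)). pose proof (Z_to_nat_opp (d 4%nat)).
    pose proof (Z_to_nat_opp (s 5%nat)). pose proof (Z_to_nat_opp (d 5%nat)).
    repeat match goal with
    | H : context [Z.to_nat ?x] |- _ => let q := fresh "q" in set (q := Z.to_nat x) in *; clearbody q
    end.
    unfold s, d, plidx, sum6 in *. fold h in Hn. lia.
  - exists (fun e => cst n h m * v e). split; [|split].
    + apply cv0_mult; [apply cv0_const|auto].
    + rewrite EU, EL, EZ, E0 in Iv.
      replace (2 * RtoC PI * Ci * (cst n h m * v 0%R))
        with (cst n h m * (2 * RtoC PI * Ci * v 0%R) + 0 * (2 * RtoC PI * Ci * v 0%R)) by ring.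
      refine (contour_integral_lin g dg _ _ _ _ _ _ _ Iv Iv _).
      intros t. rewrite FN_form. fold h. fold s. fold d. ring.
    + intros e He. unfold Jm, Lam. rewrite Dv.
      * rewrite EU, EL, EZ, <- dd_scal. symmetry. apply dd_ext. intros y _.
        apply (regular_part_form (fun k => af k e)).
      * split; rewrite EU.
        -- now apply generic_nodes_NoDup.
        -- rewrite EL. intros p q Hp Hq. apply nodes_snd in Hp. destruct Hp as (j & Hj & Hp).
           apply in_flat_map in Hq. destruct Hq as (k & Hk & Hq).
           apply in_map_iff in Hq. destruct Hq as (q' & <- & Hq). apply Upl_snd in Hq.
           apply in_seq in Hj, Hk. destruct He as [He _].
           specialize (He j k ltac:(lia) ltac:(lia)).
           apply C_neq_snd. simpl. rewrite Hp, Hq. lra.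
Qed.

Lemma Jm_support (a : nat -> C) (n : nat -> Z) (h m : Z) :
  generic a -> (0 <= h <= 1)%Z -> (sum6 n + 3 * h = 2)%Z ->
  (Z.of_nat (bound6 n) < Z.abs m)%Z -> Jm a n h m = 0.
Proof.
  intros Ha Hh Hn Hm.
  pose proof (idx_bounded_bound6 n _ (le_n _)) as HB.
  destruct (Z_lt_le_dec 0 m).
  - apply Lam_high. intros k Hk. specialize (HB k Hk). unfold plidx. lia.
  - apply (Lam_low a n h m 2); auto.
    + apply (dd_degree_ext 2 2 (fun y => 1 * (1 * (y - Nc h m)) * (1 * (y - - Nc h m))));
        auto; [|intros; ring].
      apply dd_degree_mul, dd_degree_mul, (dd_degree_cst 1).
    + intros k Hk. specialize (HB k Hk). unfold plidx. lia.
    + lia.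
Qed.

Lemma at_right_0_affine_neq_0 (u w : R) : w <> 0%R -> at_right 0 (fun e => (u + e * w)%R <> 0%R).
Proof.
  intros Hw. destruct (Req_dec u 0) as [->|Hu].
  - exists (mkposreal 1 Rlt_0_1). intros e _ He. nra.
  - assert (Hr : (0 < Rabs u / Rabs w)%R)
      by (apply Rdiv_lt_0_compat; apply Rabs_pos_lt; auto).
    exists (mkposreal _ Hr). intros e Hb He H0.
    change (Rabs (e - 0) < Rabs u / Rabs w)%R in Hb. rewrite Rminus_0_r in Hb.
    assert (E : Rabs u = (Rabs e * Rabs w)%R).
    { rewrite <- Rabs_mult, <- Rabs_Ropp. f_equal. lra. }
    assert (Hw' : (0 < Rabs w)%R) by (apply Rabs_pos_lt; auto).
    rewrite E in Hb. replace (Rabs e * Rabs w / Rabs w)%R with (Rabs e) in Hb by (field; lra). lra.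
Qed.

Lemma filter_forall_lt (F : (R -> Prop) -> Prop) (HF : Filter F) (N : nat) (P : nat -> R -> Prop) :
  (forall k, (k < N)%nat -> F (P k)) -> F (fun e => forall k, (k < N)%nat -> P k e).
Proof.
  induction N as [|N IH]; intros H.
  - apply filter_forall. intros e k Hk. lia.
  - generalize (filter_and _ _ (IH (fun k Hk => H k (Nat.lt_lt_succ_r _ _ Hk))) (H N (Nat.lt_succ_diag_r N))).
    apply filter_imp. intros e [H1 H2] k Hk.
    destruct (Nat.eq_dec k N) as [->|]; auto. apply H1. lia.
Qed.

(* The imaginary perturbation directions sum to zero and are pairwise neither equal nor opposite. *)
Definition direction (k : nat) : R := nth k (1 :: 2 :: 3 :: 4 :: 5 :: -15 :: nil)%R 0%R.

Definition perturb (a : nat -> C) (k : nat) (e : R) : C := a k + RtoC e * (RtoC (direction k) * Ci).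

Lemma perturb_snd (a : nat -> C) (k : nat) (e : R) :
  snd (perturb a k e) = (snd (a k) + e * direction k)%R.
Proof. simpl. ring. Qed.

Lemma perturb_generic (a : nat -> C) : at_right 0 (fun e => generic (fun k => perturb a k e)).
Proof.
  assert (H1 : at_right 0 (fun e => forall j, (j < 6)%nat -> forall k, (k < 6)%nat ->
    (snd (perturb a j e) + snd (perturb a k e) <> 0)%R)).
  { apply filter_forall_lt; [apply at_right_proper_filter|]. intros j Hj.
    apply filter_forall_lt; [apply at_right_proper_filter|]. intros k Hk.
    assert (Hw : (direction j + direction k <> 0)%R).
    { unfold direction. do 6 (destruct j as [|j];
        [do 6 (destruct k as [|k]; [cbn [nth]; lra|]); lia|]). lia. }
    generalize (at_right_0_affine_neq_0 (snd (a j) + snd (a k)) _ Hw).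
    apply filter_imp. intros e He. rewrite !perturb_snd. lra. }
  assert (H2 : at_right 0 (fun e => forall j, (j < 6)%nat -> forall k, (k < 6)%nat -> j <> k ->
    (snd (perturb a j e) <> snd (perturb a k e)))).
  { apply filter_forall_lt; [apply at_right_proper_filter|]. intros j Hj.
    apply filter_forall_lt; [apply at_right_proper_filter|]. intros k Hk.
    destruct (Nat.eq_dec j k) as [->|Hjk]; [apply filter_forall; intros e H; now elim H|].
    assert (Hw : (direction j - direction k <> 0)%R).
    { unfold direction. do 6 (destruct j as [|j];
        [do 6 (destruct k as [|k]; [cbn [nth]; solve [lra|lia]|]); lia|]). lia. }
    generalize (at_right_0_affine_neq_0 (snd (a j) - snd (a k)) _ Hw).
    apply filter_imp. intros e He _. rewrite !perturb_snd. lra. }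
  generalize (filter_and _ _ H1 H2). apply filter_imp. intros e [G1 G2]. split; auto.
Qed.

Lemma perturb_cv0 (a : nat -> C) (k : nat) : cv0 (perturb a k).
Proof.
  apply cv0_plus; [apply cv0_const|]. apply cv0_mult; [|apply cv0_const].
  apply filterlim_C_pair; simpl.
  - intros P [eps He]. exists eps. intros y Hy _. apply He, Hy.
  - apply filterlim_const.
Qed.

Lemma perturb_0 (a : nat -> C) (k : nat) : perturb a k 0%R = a k.
Proof. unfold perturb. ring. Qed.

Lemma perturb_sum (a : nat -> C) (e : R) : sumC 6 (fun k => perturb a k e) = sumC 6 a.
Proof. unfold perturb, direction. cbn [sumC nth]. ring. Qed.

(** * Continuity in the perturbation and passage to the limit *)

Lemma cv0_prodC (k : nat) (f : nat -> R -> C) :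
  (forall i, (i < k)%nat -> cv0 (f i)) -> cv0 (fun e => prodC k (fun i => f i e)).
Proof.
  induction k as [|k IH]; intros H; simpl; [apply cv0_const|].
  apply cv0_mult; auto.
Qed.

Lemma cv0_sumC (k : nat) (f : nat -> R -> C) :
  (forall i, cv0 (f i)) -> cv0 (fun e => sumC k (fun i => f i e)).
Proof.
  induction k as [|k IH]; intros H; simpl; [apply cv0_const|].
  apply cv0_plus; auto.
Qed.

Lemma cv0_unique (f f' : R -> C) : cv0 f -> cv0 f' -> at_right 0 (fun e => f e = f' e) ->
  f 0%R = f' 0%R.
Proof.
  intros Hf Hf' E.
  apply (filterlim_locally_unique (F := at_right 0) (V := CR) f); auto.
  apply (filterlim_ext_loc f'); auto.
  revert E. apply filter_imp. auto.
Qed.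

Lemma cv0_gam (x : R -> C) (s : Z) : cv0 x ->
  (forall i : nat, (Z.of_nat i < 1 - s)%Z -> x 0%R <> RtoC (IZR (s + 2 * Z.of_nat i))) ->
  cv0 (fun e => gam (x e) s).
Proof.
  intros Hx Hs. unfold gam.
  assert (Hb : cv0 (fun e => 1 + (x e - RtoC (IZR s)) / 2)).
  { apply cv0_plus; [apply cv0_const|]. apply cv0_mult; [|apply cv0_const].
    apply cv0_minus; [auto|apply cv0_const]. }
  destruct (Z_le_gt_dec 1 s) as [Hs1|Hs1].
  - replace (s - 1)%Z with (Z.of_nat (Z.to_nat (s - 1))) by lia.
    match goal with |- cv0 ?f => replace f with (fun e => prodC (Z.to_nat (s - 1))
      (fun i => 1 + (x e - RtoC (IZR s)) / 2 + RtoC (INR i))) end.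
    + apply cv0_prodC. intros i _. apply cv0_plus; auto. apply cv0_const.
    + apply functional_extensionality. intros e. now rewrite poch_nat.
  - set (k := Z.to_nat (1 - s)). replace (s - 1)%Z with (- Z.of_nat k)%Z by lia.
    match goal with |- cv0 ?f => replace f with (fun e => / prodC k
      (fun i => 1 + (x e - RtoC (IZR s)) / 2 - RtoC (INR (S i)))) end.
    + apply cv0_inv.
      * apply prodC_neq_0. intros i Hi E. apply (Hs i); [lia|].
        transitivity (2 * (1 + (x 0%R - RtoC (IZR s)) / 2 - RtoC (INR (S i)))
          + RtoC (IZR (s + 2 * Z.of_nat i))); [|rewrite E; ring].
        rewrite INR_IZR_INZ, Nat2Z.inj_succ. unfold Z.succ. push_IZR. field.
      * apply cv0_prodC. intros i _. apply cv0_minus; auto. apply cv0_const.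
    + apply functional_extensionality. intros e. now rewrite poch_neg.
Qed.

(* At [N = -N_j], [y = -a_j] is a pole of the [j]-th plus-sign factor, so no minus-sign factor
   may have a pole there. *)
Lemma separating_no_collision (half : bool) (a : nat -> C) (n : nat -> Z) (g dg : Z -> R -> C)
    (hC : forall m : Z, separating_contour half a n m (g m) (dg m)) (j k i : nat) :
  (j < 6)%nat -> (k < 6)%nat -> (Z.of_nat i < 1 - (n j + n k + twonu half))%Z ->
  a j + a k <> RtoC (IZR (n j + n k + twonu half + 2 * Z.of_nat i)).
Proof.
  set (h := twonu half). intros Hj Hk Hi E.
  destruct (hC (- n j - h)%Z) as (_ & HPl & HMi).
  apply (left_right_neq (g (- n j - h)%Z) (dg (- n j - h)%Z) (- a j) (- a j)); auto.
  - apply (HPl j); auto. split.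
    + unfold plus_idx. fold h. lia.
    + exists 1%nat. split; [lia|]. split; [unfold plus_idx; fold h; lia|].
      rewrite plus_factor. fold h. unfold plidx.
      replace (n j + (- n j - h) + h)%Z with 0%Z by lia. simpl. field.
  - apply (HMi k); auto. split.
    + unfold minus_idx. lia.
    + exists (S i). split; [lia|]. split; [unfold minus_idx; lia|].
      rewrite minus_factor, INR_IZR_INZ, Nat2Z.inj_succ. unfold Z.succ.
      replace (a k - - a j) with (a j + a k) by ring. rewrite E. push_IZR. field.
Qed.

Lemma sum6_of_shiftC (half : bool) (n : nat -> Z) :
  sumC 6 (fun k => shiftC half (n k)) = RtoC 2 -> (sum6 n + 3 * twonu half = 2)%Z.
Proof.
  unfold shiftC, sum6. cbn [sumC]. rewrite <- !RtoC_plus. intros H. apply RtoC_inj in H.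
  apply eq_IZR. rewrite !plus_IZR, mult_IZR.
  destruct half; simpl in *; lra.
Qed.

(* nu = nuR half; N_k = n k + nu (k = 0..5 standing for k = 1..6);
   N = m + nu ranges over Z + nu as m ranges over Z. *)
Theorem theorem1 (half : bool) (n : nat -> Z) (a : nat -> C)
  (hN : sumC 6 (fun k => shiftC half (n k)) = RtoC 2)
  (ha : sumC 6 a = RtoC 0)
  (g dg : Z -> R -> C)
  (hC : forall m : Z, separating_contour half a n m (g m) (dg m)) :
  exists (I : Z -> C) (M : nat),
    (forall m : Z, is_contour_integral (FN half a n m) (g m) (dg m) (I m)) /\
    (forall m : Z, (Z.of_nat M < Z.abs m)%Z -> I m = 0) /\
    / (RtoC 8 * RtoC PI * Ci) * sumZ M I =
    prodC 6 (fun k => prodC k (fun j =>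
      poch (1 + (a j + a k - shiftC half (n j) - shiftC half (n k)) / 2)
           (n j + n k + twonu half - 1)%Z)).
Proof.
  apply sum6_of_shiftC in hN. set (h := twonu half) in *.
  assert (Hh : (h = 0 \/ h = 1)%Z) by (unfold h; destruct half; auto).
  pose proof (fun m => constructive_indefinite_description _
    (FN_integral_family half a n m (g m) (dg m) (perturb a) hN (hC m) (perturb_cv0 a) (perturb_0 a)))
    as HV.
  set (v := fun m => proj1_sig (HV m)).
  assert (Cv : forall m, cv0 (v m)) by (intros m; apply (proj2_sig (HV m))).
  assert (Iv : forall m, is_contour_integral (FN half a n m) (g m) (dg m)
    (2 * RtoC PI * Ci * v m 0%R)) by (intros m; apply (proj2_sig (HV m))).
  assert (Jv : forall m e, generic (fun k => perturb a k e) ->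
    v m e = Jm (fun k => perturb a k e) n h m) by (intros m; apply (proj2_sig (HV m))).
  clearbody v. clear HV.
  set (K := bound6 n).
  assert (V0 : forall m, (Z.of_nat K < Z.abs m)%Z -> v m 0%R = 0).
  { intros m Hm. apply (cv0_unique (v m) (fun _ => RtoC 0)); auto using cv0_const.
    generalize (perturb_generic a). apply filter_imp. intros e He.
    rewrite Jv by auto. apply Jm_support; auto. lia. }
  assert (S0 : sumZ K (fun m => v m 0%R) = 4 * Rp a n h).
  { assert (E : Rp a n h = Rp (fun k => perturb a k 0%R) n h).
    { f_equal. apply functional_extensionality. intros k. symmetry. apply perturb_0. }
    rewrite E.
    apply (cv0_unique (fun e => sumZ K (fun m => v m e))
      (fun e => 4 * Rp (fun k => perturb a k e) n h)).
    - apply (cv0_sumC _ (fun i => v (Z.of_nat i - Z.of_nat K)%Z)). auto.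
    - apply cv0_mult; [apply cv0_const|].
      apply (cv0_prodC 6 (fun k e => prodC k (fun j =>
        gam (perturb a j e + perturb a k e) (n j + n k + h)))).
      intros k Hk.
      apply (cv0_prodC k (fun j e => gam (perturb a j e + perturb a k e) (n j + n k + h))).
      intros j Hj. apply (cv0_gam (fun e => perturb a j e + perturb a k e)).
      + apply cv0_plus; apply perturb_cv0.
      + intros i Hi. rewrite !perturb_0.
        apply (separating_no_collision half a n g dg hC); auto. lia.
    - generalize (perturb_generic a). apply filter_imp. intros e He.
      destruct (evaluation_generic (fun k => perturb a k e) n h Hh He) as [M0 HM0]; auto.
      { now rewrite perturb_sum. }
      (* [M0] depends on [e], so the sum is cut back to the fixed range [K] before [e] tends to
         0. *)
      rewrite <- (HM0 (Nat.max M0 K)) by lia.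
      rewrite (sumZ_support K (Nat.max M0 K)); [|intros m Hm; apply Jm_support; auto; lia|lia].
      apply sumZ_ext. intros m. now apply Jv. }
  exists (fun m => 2 * RtoC PI * Ci * v m 0%R), K. split; [exact Iv|]. split.
  - intros m Hm. rewrite V0 by auto. ring.
  - rewrite sumZ_scal, S0.
    assert (HPI : RtoC PI <> 0) by (intros H; apply RtoC_inj in H; pose proof PI_RGT_0; lra).
    transitivity (Rp a n h).
    + field. split; [exact Ci_nz|exact HPI].
    + apply prodC_ext. intros k _. apply prodC_ext. intros j _. unfold gam. f_equal.
      rewrite !shiftC_Nc. fold h. unfold Nc. push_IZR. field.
Qed.
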